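(* Let $\mathcal{X}$ be a radial tree with the measure $\mu$ and let $\mathcal{P}$ be the Bergman projector on $\mathcal{X}$, all as described in the context. Then: (a) $\mathcal{P}$ maps $\mathrm{H}^1(\mathcal{X})$ boundedly to $\mathrm{H}^1(\mathcal{X})$; (b) $\mathcal{P}$ maps $\mathrm{BMO}(\mathcal{X})$ boundedly to $\mathrm{BMO}(\mathcal{X})$.
   Context: **Tree and measure.** $\mathcal{X}$ is an infinite tree (connected graph without cycles) with a distinguished vertex $0$ (origin), $d$ is the graph distance and $|x|=d(x,0)$. The number of children of $x$ (neighbours $y$ of $x$ with $|y|=|x|+1$) is denoted $q(x)$. $\mathcal{X}$ is radial: there is $\tilde q:\{0,1,2,\dots\}\to\{2,3,4,\dots\}$ with $q(x)=\tilde q(|x|)$ for all $x$ ($\tilde q$ may be unbounded). For $x\ne 0$, $x^{(1)}$ is the neighbour of $x$ with $|x^{(1)}|=|x|-1$, and $x^{(k)}$ is the $k$-th iterate. Fix $\alpha>1$ and let $\mu(\{x\})=c\prod_{\ell=0}^{|x|-1}\tilde q(\ell)^{-\alpha}$, with $c>0$ chosen so that $\mu(\mathcal{X})=1$. $L^p(\mathcal{X})=L^p(\mathcal{X},\mu)$ (real-valued functions). **Dyadic sets.** The sector with vertex $x$ is $S_x=\{x\}\cup\{y: y^{(k)}=x\text{ for some }k\ge1\}$. For $k\ge0$ let $\mathscr{D}_k$ be the partition $\{\{x\}:|x|<k\}\cup\{S_y:|y|=k\}$ of $\mathcal{X}$ (so $\mathscr{D}_0=\{\mathcal{X}\}$).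 **Function spaces.** Write $\langle f\rangle_Q=\mu(Q)^{-1}\sum_{x\in Q}f(x)\mu(\{x\})$, $\mathsf{E}_kf=\sum_{Q\in\mathscr{D}_k}\langle f\rangle_Q1_Q$ and $\mathsf{D}_kf=\mathsf{E}_kf-\mathsf{E}_{k-1}f$ for $k\ge1$. Then $$\|f\|_{\mathrm{BMO}}=\|\mathsf{E}_0f\|_\infty+\sup_{k\ge1}\big\|\mathsf{E}_k|f-\mathsf{E}_{k-1}f|\big\|_\infty ,\qquad \|f\|_{\mathrm{H}^1}=\Big\|\Big(\sum_{k\ge1}|\mathsf{D}_kf|^2\Big)^{1/2}\Big\|_{L^1(\mathcal{X})}.$$ $\mathrm{BMO}(\mathcal{X})$ is the space of $f\in L^1(\mathcal{X})$ with $\|f\|_{\mathrm{BMO}}<\infty$, and $\mathrm{H}^1(\mathcal{X})$ is the space of $f\in L^1(\mathcal{X})$ with $\sum_xf(x)\mu(\{x\})=0$ and $\|f\|_{\mathrm{H}^1}<\infty$. **Bergman projector.** The combinatorial Laplacian is $\Delta f(x)=f(x)-\frac{1}{\#\{y:d(x,y)=1\}}\sum_{y:d(x,y)=1}f(y)$; $f$ is harmonic if $\Delta f=0$ on $\mathcal{X}$. The Bergman space $\mathcal{A}^2(\mathcal{X})$ is the closed subspace of harmonic functions in $L^2(\mathcal{X})$. $\mathcal{P}$ is the orthogonal projection of $L^2(\mathcal{X})$ onto $\mathcal{A}^2(\mathcal{X})$. It is given by $\mathcal{P}f(x)=\sum_y K(x,y)f(y)\mu(\{y\})$, where $K$ is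 the reproducing kernel of $\mathcal{A}^2(\mathcal{X})$; for each fixed $x$, $K(x,\cdot)$ is bounded, and $\mathcal{P}f$ is defined by this formula for $f\in L^1(\mathcal{X})$. *)

(* Defs.v *)
From HB Require Import structures.
From mathcomp Require Import all_boot all_order all_algebra.
From mathcomp Require Import finmap.
From mathcomp Require Import all_classical all_reals all_analysis.

Set Implicit Arguments.
Unset Strict Implicit.
Unset Printing Implicit Defensive.

Import Order.TTheory GRing.Theory Num.Theory.
Import numFieldNormedType.Exports.

Local Open Scope classical_set_scope.
Local Open Scope ring_scope.

Section Tree.
Variables (T : pointedType) (adj : rel T).

(* [ucycle adj [:: x; y]] holds for every edge, hence the bound 3; the
   irreflexivity clause excludes loops. *)
Definition is_tree : Prop :=
  [/\ symmetric adj, irreflexive adj,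
      forall x y, exists2 p, path adj x p & last x p = y &
      forall c : seq T, ucycle adj c -> (size c < 3)%N].

Definition walk (x y : T) (n : nat) : Prop :=
  exists p, [/\ path adj x p, last x p = y & size p = n].

Definition gdist (x y : T) : nat :=
  xget 0%N [set n | walk x y n /\ forall m, walk x y m -> (n <= m)%N].

Variable o : T.

Definition level (x : T) : nat := gdist x o.

Definition children (x : T) : set T :=
  [set y | adj x y /\ level y = (level x).+1].

Definition radial (q : nat -> nat) : Prop :=
  forall x, (children x #= `I_(q (level x)))%card.

(* The default value makes [parent o = o]; [sector] only uses the k-th iterate
   at y when k <= level y, where every step goes down one level. *)
Definition parent (x : T) : T :=
  xget x [set y | adj x y /\ level x = (level y).+1].

Definition sector (x : T) : set T :=
  [set y | y = x \/
    exists k, [/\ (1 <= k)%N, (k <= level y)%N & iter k parent y = x]].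

Definition dyadic (k : nat) : set (set T) :=
  [set [set x] | x in [set x | (level x < k)%N]] `|`
  [set sector y | y in [set y | level y = k]].

Definition sphere1 (x : T) : set T := [set y | gdist x y = 1%N].

Definition laplacian (R : realType) (f : T -> R) (x : T) : R :=
  f x - #|` fset_set (sphere1 x)|%fset%:R^-1 * \sum_(y \in sphere1 x) f y.

Definition harmonic (R : realType) (f : T -> R) : Prop :=
  forall x, laplacian f x = 0.

End Tree.

Section Spaces.
Context (R : realType) (d : measure_display) (T : measurableType d).
Variables (adj : rel T) (o : T) (mu : probability T R).

Definition tree_measure (q : nat -> nat) (alpha : R) : Prop :=
  exists2 c : R, 0 < c &
    forall x, mu [set x] =
      (c * \prod_(l < level adj o x) ((q l)%:R `^ (- alpha)))%:E.

Definition average (f : T -> R) (Q : set T) : R :=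
  (fine (mu Q))^-1 * \int[mu]_(x in Q) f x.

(* At each x a single Q contributes, so the finitely supported sum over the
   family [dyadic adj o k] is the full sum. *)
Definition cexp (k : nat) (f : T -> R) (x : T) : R :=
  \sum_(Q \in dyadic adj o k) average f Q * \1_Q x.

(* Only meaningful for k >= 1. *)
Definition mdiff (k : nat) (f : T -> R) (x : T) : R :=
  cexp k f x - cexp k.-1 f x.

Definition bmo_norm (f : T -> R) : \bar R :=
  ('N[mu]_+oo[EFin \o cexp 0 f] +
   ereal_sup [set 'N[mu]_+oo[EFin \o cexp k (fun x => `|f x - cexp k.-1 f x|)%R]
             | k in [set k | (1 <= k)%N]])%E.

Definition square_function (f : T -> R) (x : T) : \bar R :=
  ((\sum_(1 <= k <oo) (`|mdiff k f x| ^+ 2)%R%:E) `^ 2^-1)%E.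

Definition h1_norm (f : T -> R) : \bar R := 'N[mu]_1[square_function f]%E.

Definition BMO : set (T -> R) :=
  [set f | f \in Lfun mu 1 /\ (bmo_norm f < +oo)%E].

Definition H1 : set (T -> R) :=
  [set f | [/\ f \in Lfun mu 1, \int[mu]_x f x = 0 & (h1_norm f < +oo)%E]].

Definition bergman : set (T -> R) :=
  [set f | f \in Lfun mu 2%:E /\ harmonic adj f].

(* Reproducing kernel: K(x, .) is the (unique) element of the Bergman space
   representing evaluation at x. *)
Definition bergman_kernel (x : T) : T -> R :=
  xget (cst 0) [set k | bergman k /\
    forall h, bergman h -> h x = \int[mu]_y (k y * h y)].

Definition bergman_projector (f : T -> R) (x : T) : R :=
  \int[mu]_y (bergman_kernel x y * f y).

Definition maps_boundedly (P : (T -> R) -> T -> R) (S : set (T -> R))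
    (N : (T -> R) -> \bar R) : Prop :=
  exists C : R, forall f, S f -> S (P f) /\ (N (P f) <= C%:E * N f)%E.

End Spaces.

(* Main.v *)
Require Import Defs.
From HB Require Import structures.
From mathcomp Require Import all_boot all_order all_algebra.
From mathcomp Require Import finmap.
From mathcomp Require Import all_classical all_reals all_analysis.
From mathcomp Require Import ess_sup_inf.
From mathcomp Require Import ring lra zify.

Set Implicit Arguments.
Unset Strict Implicit.
Unset Printing Implicit Defensive.

Import Order.TTheory GRing.Theory Num.Theory.
Import numFieldNormedType.Exports.

Local Open Scope classical_set_scope.
Local Open Scope ring_scope.

(** The theorem rests on one property of the measure: the total mass of the
    children of a vertex is at most [rate = 2 `^ (1 - alpha) < 1] times the mass
    of the vertex ([q_mass]).  Every sector therefore carries a fixed proportion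
    of its mass at its vertex ([sector_mass_le]), and summing a nonnegative
    function along all paths to the root costs only a constant in the integral
    ([integral_increments]).  Write [jump f y] for the difference of the averages
    of [f] over the sectors of [y] and of its parent.  The martingale
    difference with value [jump f y] is constant on the sector of [y], of which
    the vertex is a definite part, so no cancellation between generations has to
    be exploited: up to constants the H^1 norm of a function of mean zero
    is the integral of [`|jump f|], and the BMO norm is the absolute value of
    the mean plus the supremum of [`|jump f|].

    A function [h] is harmonic exactly when its increments
    [grad h y = h y - h (parent y)] are balanced: at every vertex the increments
    towards the children add up to the increment at the vertex ([harmonicP]).
    The basic solutions are the [bwave]s: on the sector of [y] they follow the
    radial profile [phi], and the mean over the siblings of [y] is subtracted so
    that the increments entering at the parent of [y] cancel.  They generate the
    Bergman space together with the constants, which gives its reproducing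
    kernel by a recursion along the path to the root ([bergman_kernelE]).  For
    the projection [proj f] the recursion reads
    [grad (proj f) y = coef f y + grad (proj f) (parent y) / q], where [coef f y]
    is the moment of [f] against the profile on the sector of [y], minus the mean
    of the moments over the siblings, divided by the energy of the profile
    ([incr_op_rec], [grad_proj]).

    Both halves now follow from estimates of absolute values.  In the BMO case
    the moments of [f] minus its average over the parent sector are bounded by
    the mean oscillation ([abs_coef_bmo]), the recursion halves what it inherits
    ([abs_incr_op_bmo]), and bounded increments give bounded mean oscillation
    ([oscillation_le]).  In the H^1 case these moments satisfy a recursion
    towards the leaves driven by [jump f] ([moment_dev_step]); each step halves
    the contribution of the next generation, so their sum is controlled by the
    integral of [`|jump f|] ([sum_moment_dev_le]).  Finally the sector averages of
    a harmonic function differ from its values by at most one increment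
    ([avg_balanced]), so that its square function is at most three times the sum
    of its increments along the path to the root ([sqf_balanced_le]), and
    [integral_increments] applies again. *)

(** * Rooted trees *)

Section TreeGeometry.
Context {T : pointedType} {adj : rel T} {o : T}.
Hypothesis htree : is_tree adj.

Local Notation level := (level adj o).
Local Notation parent := (parent adj o).
Local Notation children := (children adj o).
Local Notation sector := (sector adj o).

Lemma adj_sym x y : adj x y = adj y x.
Proof. by case: htree => s _ _ _; exact: s. Qed.

Lemma adj_neq x y : adj x y -> x != y.
Proof. by case: htree => _ i _ _ a; apply/eqP => xy; rewrite xy i in a. Qed.

(** Connectedness makes the set of walk lengths nonempty, so that the default
    value in the definition of the distance is never taken. *)
Lemma gdistP x y : walk adj x y (gdist adj x y) /\
  forall m, walk adj x y m -> (gdist adj x y <= m)%N.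
Proof.
have [n wn] : exists n, walk adj x y n.
  case: htree => _ _ c _; have [p pp lp] := c x y.
  by exists (size p), p.
have ex : exists n, `[< walk adj x y n >] by exists n; apply/asboolP.
apply: (@xgetPex _ 0%N [set n | walk adj x y n /\ _]).
exists (ex_minn ex); case: ex_minnP => m /asboolP wm mmin.
by split=> // k wk; apply: mmin; apply/asboolP.
Qed.

Lemma level_root : level o = 0%N.
Proof.
apply/eqP; rewrite -leqn0; apply: (gdistP o o).2.
by exists [::].
Qed.

Lemma level_eq0 x : (level x == 0)%N = (x == o).
Proof.
apply/eqP/eqP => [l0|->]; last exact: level_root.
have [[p [_ lp sp]] _] := gdistP x o.
rewrite -/(Defs.level adj o x) l0 in sp.
by rewrite (size0nil sp) in lp.
Qed.

Lemma level_adj x y : adj x y -> (level x <= (level y).+1)%N.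
Proof.
move=> xy; apply: (gdistP x o).2.
have [[p [pp lp sp]] _] := gdistP y o.
by exists (y :: p); rewrite /= xy sp.
Qed.

Lemma ex_parent x : x != o -> exists y, adj x y /\ level x = (level y).+1.
Proof.
move=> xo; have [[p [pp lp sp]] _] := gdistP x o.
rewrite -/(Defs.level adj o x) in sp.
case: p pp lp sp => [|y p] /=; first by move=> _ xo'; rewrite xo' eqxx in xo.
case/andP=> xy pp lp sp; exists y; split=> //.
apply/eqP; rewrite eqn_leq level_adj//= -sp ltnS.
by apply: (gdistP y o).2; exists p.
Qed.

Lemma parentP x : x != o -> adj x (parent x) /\ level x = (level (parent x)).+1.
Proof.
move=> xo; have [y Py] := ex_parent xo.
exact: (@xgetPex _ x [set y | adj x y /\ level x = (level y).+1] (ex_intro _ y Py)).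
Qed.

Lemma geodesic x : exists p, [/\ path adj x p, last x p = o &
  forall z, z \in p -> (level z < level x)%N].
Proof.
have [n] := ubnP (level x); elim: n x => // n IH x; rewrite ltnS => lx.
have [->|xo] := eqVneq x o; first by exists [::].
have [y [xy ly]] := ex_parent xo.
have [|p [pp lp hp]] := IH y; first by rewrite -ly.
exists (y :: p); split => //=; first by rewrite xy.
move=> z; rewrite inE => /orP[/eqP->|/hp]; rewrite ly// => h.
exact: ltn_trans h _.
Qed.

(** A path between two distinct neighbours of [z] that avoids [z] would close up
    to a cycle through [z]. *)
Lemma no_detour z a b p : adj z a -> adj z b -> a != b ->
  path adj a p -> last a p = b -> z \notin a :: p -> False.
Proof.
move=> za zb ab pp lp zp.
case/shortenP: pp lp => p' pp' up' sp' lp.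
have zp' : z \notin a :: p'.
  apply: contra zp; rewrite !inE => /orP[->//|/sp' ->]; exact: orbT.
case: htree => _ _ _ /(_ [:: z, a & p']) /=.
case: p' pp' up' lp zp' {sp'} => [|c p'] pp up lp zp' h.
  by rewrite /= in lp; rewrite lp eqxx in ab.
suff : (size [:: z, a, c & p'] < 3)%N by [].
apply: h; rewrite /ucycle /cycle [uniq _]/= zp'.
apply/andP; split; last exact: up.
rewrite rcons_path [path _ _ _]/= za -/(path adj a (c :: p')) pp /=.
by rewrite (_ : last c p' = b)// adj_sym.
Qed.

(** The geodesics from two lower neighbours of [z] to the root stay below the
    level of [z], hence join these neighbours by a path that avoids [z].  Taking
    [<=] rather than [<] also excludes edges inside a level. *)
Lemma lower_neighbour_unique z a b : adj z a -> adj z b ->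
  (level a <= level z)%N -> (level b <= level z)%N -> a = b.
Proof.
move=> za zb la lb; apply/eqP/negPn/negP => ab.
have [p [pp lp hp]] := geodesic a.
have [r [pr lr hr]] := geodesic b.
pose r' := rev (belast b r).
have pr' : path adj o r'.
  rewrite -lr rev_path; have : symmetric adj by move=> ? ?; exact: adj_sym.
  by move=> s; rewrite (@eq_path _ _ adj).
have lr' : last o r' = b.
  rewrite -lr -[b in RHS](last_rcons o (rev r)) -rev_cons lastI rev_rcons.
  by [].
apply: (@no_detour z a b (p ++ r')) => //.
- by rewrite cat_path pp lp.
- by rewrite last_cat lp.
have neqz : forall c r0, adj z c -> (level c <= level z)%N ->
    (forall w, w \in r0 -> (level w < level c)%N) -> z \notin c :: r0.
  move=> c r0 zc lc h; rewrite inE negb_or adj_neq//=.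
  by apply/negP => /h; rewrite ltnNge lc.
rewrite -cat_cons mem_cat negb_or neqz//=.
have := neqz b r zb lb hr; apply: contra.
by rewrite mem_rev => /mem_belast.
Qed.

Lemma parent_root : parent o = o.
Proof.
rewrite /Defs.parent; case: xgetP => // y _ [_].
by rewrite level_root.
Qed.

Lemma level_parent x : level (parent x) = (level x).-1.
Proof.
have [->|/parentP[_ ->]//] := eqVneq x o.
by rewrite parent_root level_root.
Qed.

(** Induction along the path from a vertex to the root. *)
Lemma level_ind (P : T -> Prop) : P o -> (forall y, y != o -> P (parent y) -> P y) ->
  forall y, P y.
Proof.
move=> Po Ps y; have [n] := ubnP (level y); elim: n y => // n IH y ly.
have [->//|yo] := eqVneq y o.
apply: Ps => //; apply: IH; rewrite level_parent.
by move: ly; rewrite -level_eq0 in yo; lia.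
Qed.

Lemma level_rec y : y != o -> level y = (level (parent y)).+1.
Proof. by move=> yo; case: (parentP yo). Qed.

Lemma childP x y : children x y <-> y != o /\ parent y = x.
Proof.
split=> [[xy ly]|[yo <-]]; last first.
  by have [a l] := parentP yo; split=> //; rewrite adj_sym.
have yo : y != o by rewrite -level_eq0 ly.
split=> //; have [a l] := parentP yo.
apply: (@lower_neighbour_unique y) => //; first by rewrite adj_sym.
  by rewrite l.
by rewrite ly.
Qed.

Lemma adjP x y : adj x y <-> children x y \/ (x != o /\ y = parent x).
Proof.
split=> [xy|[[]//|[xo ->]]]; last by case: (parentP xo).
have [ly|ly] := ltnP (level x) (level y).
  left; split => //; apply/eqP; rewrite eqn_leq ly andbT.
  by apply: level_adj; rewrite adj_sym.
have xo : x != o.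
  apply: contraTneq (adj_neq xy) => xo.
  by move: ly; rewrite xo level_root leqn0 level_eq0 => /eqP->; rewrite eqxx.
right; split=> //; have [a l] := parentP xo.
by apply: (@lower_neighbour_unique x) => //; rewrite l.
Qed.

Lemma sphere1E x : sphere1 adj x = [set y | adj x y].
Proof.
rewrite /sphere1; apply/seteqP; split=> y /=.
  move=> g1; have [[p [pp lp sp]] _] := gdistP x y; rewrite g1 in sp.
  case: p pp lp sp => [|w [|]]//= /andP[xw _] <- _; exact: xw.
move=> xy; apply/eqP; rewrite eqn_leq; apply/andP; split.
  by apply: (gdistP x y).2; exists [:: y]; rewrite /= xy.
rewrite lt0n; apply/eqP => g0.
have [[p [pp lp sp]] _] := gdistP x y; rewrite g0 in sp.
by have := adj_neq xy; rewrite (size0nil sp)/= in lp; rewrite lp eqxx.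
Qed.

End TreeGeometry.

(** * Harmonic functions on a radial tree *)

Section RadialTree.
Context {R : realType} {T : pointedType} {adj : rel T} {o : T} {q : nat -> nat}.
Hypotheses (htree : is_tree adj) (hradial : radial adj o q)
  (hq : forall n, (2 <= q n)%N).

Local Notation level := (level adj o).
Local Notation parent := (parent adj o).
Local Notation children := (children adj o).
Local Notation sector := (sector adj o).

Definition ch (x : T) : seq T := fset_set (children x).

Lemma finite_children x : finite_set (children x).
Proof. by apply/finite_setP; exists (q (level x)). Qed.

Lemma mem_ch x y : (y \in ch x) = (y != o) && (parent y == x).
Proof.
rewrite in_fset_set; last exact: finite_children.
apply/idP/andP => [/set_mem/(childP htree)[? <-]//|[yo /eqP yx]].
by apply/mem_set/(childP htree).
Qed.

Lemma uniq_ch x : uniq (ch x).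
Proof. exact: fset_uniq. Qed.

Lemma size_ch x : size (ch x) = q (level x).
Proof. by rewrite /ch -(card_fset_set (hradial x)). Qed.

Lemma level_ch x y : y \in ch x -> level y = (level x).+1.
Proof.
rewrite mem_ch => /andP[yo /eqP <-].
by case: (parentP htree yo).
Qed.

Lemma parent_ch x y : y \in ch x -> parent y = x.
Proof. by rewrite mem_ch => /andP[_ /eqP]. Qed.

Lemma ch_neq_root x y : y \in ch x -> y != o.
Proof. by rewrite mem_ch => /andP[]. Qed.

Lemma ch_parent y : y != o -> y \in ch (parent y).
Proof. by move=> yo; rewrite mem_ch yo eqxx. Qed.

Lemma q_gt0 n : 0 < (q n)%:R :> R.
Proof. by rewrite ltr0n (leq_trans _ (hq n)). Qed.

Lemma q_neq0 n : (q n)%:R != 0 :> R.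
Proof. by rewrite gt_eqF// q_gt0. Qed.

Lemma qV_le_half n : (q n)%:R^-1 <= 2^-1 :> R.
Proof. by rewrite lef_pV2 ?posrE ?q_gt0// ler_nat. Qed.

Lemma sum_ch_cst x (c : R) : \sum_(y <- ch x) c = (q (level x))%:R * c.
Proof. by rewrite big_const_seq count_predT size_ch iter_addr addr0 mulr_natl. Qed.

(** At the root, [parent o = o] makes the right-hand side vanish, so that this
    one equation covers all vertices. *)
Definition balanced (h : T -> R) :=
  forall x, \sum_(y <- ch x) (h y - h x) = h x - h (parent x).

(** At [x <> o] the neighbours are the [q] children and the parent, so that
    vanishing of the Laplacian is [(q + 1) h x = h (parent x) + sum of h over
    the children]; moving [q] copies of [h x] to the right gives the balance of
    increments. *)
Lemma harmonicP (h : T -> R) : Defs.harmonic adj h <-> balanced h.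
Proof.
have finS x : finite_set (sphere1 adj x).
  rewrite (sphere1E htree).
  apply: (@sub_finite_set _ _ (children x `|` [set parent x])).
    by move=> y /= /(adjP (o := o) htree) [|[_]]; [left|right].
  by rewrite finite_setU; split; [exact: finite_children|exact: finite_set1].
have memS x y : (y \in (fset_set (sphere1 adj x) : seq T)) =
    (y \in ch x) || ((x != o) && (y == parent x)).
  rewrite in_fset_set// (sphere1E htree) mem_ch.
  apply/idP/idP => [/set_mem/=/(adjP (o := o) htree)[/(childP htree)[-> ->]|[-> ->]]|].
  - by rewrite eqxx.
  - by rewrite eqxx orbT.
  move=> hy; apply/mem_set/(adjP (o := o) htree).
  case/orP: hy => [/andP[yo /eqP yx]|/andP[xo /eqP ->]]; last by right.
  by left; apply/(childP htree).
suff lapE x : laplacian adj h x = 0 <->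
    \sum_(y <- ch x) (h y - h x) = h x - h (parent x).
  by split=> hh x; apply/lapE.
rewrite /laplacian fsbig_finite//.
rewrite big_split/= sum_ch_cst mulrN.
have qx := q_gt0 (level x).
have [xo|xo] := eqVneq x o.
  have pS : perm_eq (fset_set (sphere1 adj x)) (ch x).
    apply: uniq_perm; [exact: fset_uniq|exact: uniq_ch|move=> y].
    by rewrite memS xo eqxx orbF.
  rewrite (perm_big _ pS)/= (perm_size pS) size_ch.
  have -> : parent x = x by rewrite xo (parent_root htree).
  rewrite subrr.
  split=> [/eqP|/eqP]; rewrite subr_eq0 => /eqP.
    by move=> ->; rewrite mulrA mulfV ?mul1r ?subrr// gt_eqF.
  by move=> ->; rewrite mulrA mulVf ?mul1r ?subrr// gt_eqF.
have pS : perm_eq (fset_set (sphere1 adj x)) (parent x :: ch x).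
  apply: uniq_perm; [exact: fset_uniq| |move=> y].
    rewrite /= uniq_ch andbT; apply/negP => /level_ch.
    by rewrite (level_parent htree); lia.
  by rewrite memS xo inE orbC.
rewrite (perm_big _ pS)/= (perm_size pS) /= size_ch big_cons.
set S := \sum_(y <- ch x) h y; set c := (q (level x))%:R in qx *.
have -> : (q (level x)).+1%:R = c + 1 by rewrite -natr1.
have c1 : c + 1 != 0 by rewrite gt_eqF// ltr_wpDl// ltW.
split=> [/eqP|hS].
  rewrite subr_eq0 => /eqP e.
  have : (c + 1) * h x = h (parent x) + S by rewrite e mulrA mulfV// mul1r.
  by rewrite mulrDl mul1r => e2; lra.
have -> : h (parent x) + S = (c + 1) * h x by rewrite mulrDl mul1r; lra.
by rewrite mulrA mulVf// mul1r subrr.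
Qed.

(** The descendants of [y] exactly [i] generations below it. *)
Fixpoint desc (i : nat) (y : T) : seq T :=
  if i is i'.+1 then [seq z | w <- ch y, z <- desc i' w] else [:: y].

Lemma sum_descS i y (F : T -> R) :
  \sum_(z <- desc i.+1 y) F z = \sum_(w <- ch y) \sum_(z <- desc i w) F z.
Proof. by rewrite /= big_allpairs_dep. Qed.

Lemma sum_desc0 y (F : T -> R) : \sum_(z <- desc 0 y) F z = F y.
Proof. by rewrite /= big_seq1. Qed.

Lemma sum_descSr i y (F : T -> R) :
  \sum_(z <- desc i.+1 y) F z = \sum_(z <- desc i y) \sum_(w <- ch z) F w.
Proof.
elim: i y => [|i IH] y.
  rewrite sum_descS sum_desc0.
  by apply: eq_bigr => w _; rewrite sum_desc0.
rewrite sum_descS [RHS]sum_descS.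
by apply: eq_bigr => w _; rewrite IH.
Qed.

Lemma level_iter_parent k y : level (iter k parent y) = (level y - k)%N.
Proof.
elim: k => [|k IH]; first by rewrite subn0.
by rewrite iterS (level_parent htree) IH subnS.
Qed.

Lemma mem_desc i y z :
  (z \in desc i y) = (level z == (level y + i)%N) && (iter i parent z == y).
Proof.
elim: i y z => [|i IH] y z.
  by rewrite inE /= addn0; case: eqVneq => [->|_]; rewrite ?eqxx ?andbF.
apply/allpairsPdep/andP => [[w [a [wy aw ->]]]|[/eqP lz /eqP zy]].
  move: aw; rewrite IH => /andP[/eqP -> /eqP aw].
  by rewrite (level_ch wy) addnS addSn iterS aw (parent_ch wy).
exists (iter i parent z), z; split=> //.
  rewrite mem_ch -iterS zy eqxx andbT -(level_eq0 htree) level_iter_parent lz.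
  by rewrite -lt0n addnS subn_gt0 ltnS leq_addl.
rewrite IH eqxx andbT level_iter_parent lz; apply/eqP; lia.
Qed.

Lemma uniq_desc i y : uniq (desc i y).
Proof.
elim: i y => [//|i IH] y; rewrite /=.
apply: allpairs_uniq_dep; [exact: uniq_ch|by move=> x _; exact: IH|].
have tagE p : p \in [seq @Tagged T w (fun=> T) z | w <- ch y, z <- desc i w] ->
    tag p = iter i parent (tagged p).
  by case/allpairsPdep => w [a [_ + ->]]; rewrite mem_desc => /andP[_ /eqP ->].
move=> p p' /tagE + /tagE; case: p => w a; case: p' => w' a' /= -> -> <-.
by [].
Qed.

(** Let a flow of increments of total amount 1 enter the sector of a vertex of
    level [k] and be split evenly among the children at each vertex.  Then
    [psi k i] is the increment that arrives [i] generations further down, and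
    [phi k i] is the sum of the first [i] increments along a path.  Thus [phi k]
    is the radial profile, on a sector, of harmonic functions supported below its
    parent, the argument counting generations from the parent. *)
Definition psi (k i : nat) : R := \prod_(l < i) (q (k + l))%:R^-1.

Definition phi (k i : nat) : R := \sum_(j < i) psi k j.

Definition width (k i : nat) : R := \prod_(l < i) (q (k + l))%:R.

Lemma psi0 k : psi k 0 = 1. Proof. by rewrite /psi big_ord0. Qed.

Lemma psiSl k i : psi k i.+1 = (q k)%:R^-1 * psi k.+1 i.
Proof.
rewrite /psi big_ord_recl addn0; congr (_ * _).
by apply: eq_bigr => j _; rewrite addSnnS.
Qed.

Lemma psiSr k i : psi k i.+1 = psi k i * (q (k + i))%:R^-1.
Proof. by rewrite /psi big_ord_recr. Qed.

Lemma psi_gt0 k i : 0 < psi k i.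
Proof. by apply: prodr_gt0 => j _; rewrite invr_gt0 q_gt0. Qed.

Lemma phi0 k : phi k 0 = 0. Proof. by rewrite /phi big_ord0. Qed.

Lemma phi1 k : phi k 1 = 1. Proof. by rewrite /phi big_ord1 psi0. Qed.

Lemma phiSl k i : phi k i.+1 = 1 + (q k)%:R^-1 * phi k.+1 i.
Proof.
rewrite /phi big_ord_recl psi0 mulr_sumr; congr (_ + _).
by apply: eq_bigr => j _; rewrite psiSl.
Qed.

Lemma phiSr k i : phi k i.+1 = phi k i + psi k i.
Proof. by rewrite /phi big_ord_recr. Qed.

Lemma phi_ge0 k i : 0 <= phi k i.
Proof. by apply: sumr_ge0 => j _; exact/ltW/psi_gt0. Qed.

(** All [q] are at least 2, whence a comparison with a geometric series. *)
Lemma phi_le2 k i : phi k i <= 2.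
Proof.
elim: i k => [|i IH] k; first by rewrite phi0.
rewrite phiSl; have := ler_pM _ (phi_ge0 k.+1 i) (qV_le_half k) (IH k.+1).
by rewrite invr_ge0 ltW ?q_gt0// => /(_ isT); lra.
Qed.

Lemma phiS_ge1 k i : 1 <= phi k i.+1.
Proof. by rewrite phiSl lerDl mulr_ge0 ?phi_ge0// invr_ge0 ltW ?q_gt0. Qed.

Lemma width0 k : width k 0 = 1. Proof. by rewrite /width big_ord0. Qed.

Lemma widthSl k i : width k i.+1 = (q k)%:R * width k.+1 i.
Proof.
rewrite /width big_ord_recl addn0; congr (_ * _).
by apply: eq_bigr => j _; rewrite addSnnS.
Qed.

Lemma sum_desc_cst i y (c : R) : \sum_(z <- desc i y) c = width (level y) i * c.
Proof.
elim: i y => [|i IH] y; first by rewrite sum_desc0 width0 mul1r.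
rewrite sum_descS (eq_big_seq (fun=> width (level y).+1 i * c)) => [|w /level_ch <-//].
by rewrite sum_ch_cst widthSl mulrA.
Qed.

Lemma level_desc i y z : z \in desc i y -> level z = (level y + i)%N.
Proof. by rewrite mem_desc => /andP[/eqP]. Qed.

(** The average of a balanced function over the descendants of [y] of a fixed
    generation is affine in the increment of the function at [y]: this is what
    makes sector averages of harmonic functions explicit. *)
Lemma sum_desc_balanced h i y : balanced h ->
  \sum_(z <- desc i y) h z =
  width (level y) i * (h (parent y) + (h y - h (parent y)) * phi (level y) i.+1).
Proof.
move=> hh; elim: i y => [|i IH] y.
  by rewrite sum_desc0 width0 phi1 mulr1 mul1r addrC subrK.
rewrite sum_descS (eq_big_seq (fun w => width (level y).+1 i *
    (h y + (h w - h y) * phi (level y).+1 i.+1))); last first.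
  by move=> w wy; rewrite IH (level_ch wy) (parent_ch wy).
rewrite -mulr_sumr big_split/= sum_ch_cst -mulr_suml hh widthSl.
rewrite [phi _ i.+2]phiSl; have := q_neq0 (level y).
move: (q _)%:R (h y) (h _) (phi _ _) => a b c d a0.
by field.
Qed.

Definition in_sector y z := (level y <= level z)%N &&
  (iter (level z - level y) parent z == y).

Lemma in_sectorP y z : reflect (sector y z) (in_sector y z).
Proof.
apply: (iffP andP) => [[lyz /eqP e]|[->|[k [k1 kz e]]]].
- have [e0|e0] := posnP (level z - level y); last first.
    by right; exists (level z - level y)%N; rewrite leq_subr.
  by left; rewrite e0 in e.
- by rewrite leqnn subnn.
- have ly : level y = (level z - k)%N by rewrite -e level_iter_parent.
  by rewrite ly leq_subr subKn// e.
Qed.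

Lemma in_sector_desc y z : in_sector y z -> z \in desc (level z - level y) y.
Proof. by case/andP=> l e; rewrite mem_desc e subnKC ?eqxx. Qed.

Lemma desc_in_sector i y z : z \in desc i y -> in_sector y z.
Proof.
rewrite mem_desc => /andP[/eqP l e].
by rewrite /in_sector l leq_addr addnC addnK e.
Qed.

Lemma in_sector_refl y : in_sector y y.
Proof. by rewrite /in_sector leqnn subnn /=. Qed.

Lemma in_sector_root y : in_sector o y.
Proof.
rewrite /in_sector (level_root htree) leq0n subn0 -(level_eq0 htree).
by rewrite level_iter_parent subnn.
Qed.

Lemma in_sector_parent y z : z != y -> z != o -> in_sector y z = in_sector y (parent z).
Proof.
move=> zy zo; have lz : (0 < level z)%N by rewrite lt0n (level_eq0 htree).
rewrite /in_sector (level_parent htree).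
have [lyz|lzy] := leqP (level y) (level z).-1; last first.
  have [lyz|//] := leqP (level y) (level z).
  have -> : (level z - level y = 0)%N by lia.
  exact/negbTE.
have -> : (level y <= level z)%N by lia.
have -> : (level z - level y = ((level z).-1 - level y).+1)%N by lia.
by rewrite iterSr.
Qed.

Lemma in_sector_ch y z w : w \in ch z -> in_sector y w = in_sector y z || (w == y).
Proof.
move=> wz; have [->|wy] := eqVneq w y; first by rewrite in_sector_refl orbT.
by rewrite orbF (in_sector_parent wy) ?(ch_neq_root wz)// (parent_ch wz).
Qed.

(** At the parent of [y] the truncated subtraction gives [phi _ 0 = 0], in
    agreement with the indicator: the profile starts from 0 one step above the
    sector. *)
Definition wave y z : R := phi (level y) ((level z).+1 - level y) * (in_sector y z)%:R.

(** [balanced] in a linear form, which is inherited by the sums over siblings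
    from the waves although these are not balanced themselves. *)
Definition defect (h : T -> R) x : R :=
  \sum_(w <- ch x) (h w - h x) - (h x - h (parent x)).

Lemma balancedE h : balanced h <-> forall x, defect h x = 0.
Proof.
split=> hh x; first by rewrite /defect hh subrr.
by apply/eqP; rewrite -subr_eq0; apply/eqP; exact: hh.
Qed.

Lemma defectD (f g : T -> R) x : defect (f \+ g) x = defect f x + defect g x.
Proof.
rewrite /defect !sumrB/= big_split/=  !sum_ch_cst.
move: (\sum_(_ <- _) f _) (\sum_(_ <- _) g _) => a b; ring.
Qed.

Lemma defectZ (c : R) (f : T -> R) x : defect (fun z => c * f z) x = c * defect f x.
Proof.
rewrite /defect !sumrB/= -mulr_sumr !sum_ch_cst.
move: (\sum_(_ <- _) f _) => a; ring.
Qed.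

Lemma defect_sum (s : seq T) (F : T -> T -> R) x :
  defect (fun z => \sum_(w <- s) F w z) x = \sum_(w <- s) defect (F w) x.
Proof.
elim: s => [|w s IH].
  rewrite big_nil /defect; under eq_bigr do rewrite !big_nil subrr.
  by rewrite big1// !big_nil !subrr.
rewrite big_cons -IH -defectD; congr (defect _ x).
by apply/funext => z; rewrite big_cons.
Qed.

(** [wave y] fails to be balanced only at the parent of [y], where it feeds one
    unit of increment into the sector of [y]. *)
Lemma wave_defect y x : y != o ->
  defect (wave y) x = (x == parent y)%:R.
Proof.
move=> yo; rewrite /defect; have ly : (0 < level y)%N by rewrite lt0n (level_eq0 htree).
have [xin|xout] := boolP (in_sector y x).
  have lyx : (level y <= level x)%N by case/andP: xin.
  have xo : x != o by rewrite -(level_eq0 htree) -lt0n (leq_trans ly).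
  rewrite (eq_big_seq (fun=> psi (level y) ((level x).+1 - level y))); last first.
    move=> w wx; rewrite /wave (in_sector_ch _ wx) xin (level_ch wx).
    by rewrite subSn ?leqW// phiSr !mulr1 addrC addKr.
  rewrite sum_ch_cst subSn// psiSr subnKC//.
  have -> : wave y (parent x) = phi (level y) (level x - level y).
    rewrite /wave (level_parent htree) prednK; last exact: leq_trans lyx.
    have [xy|xy] := eqVneq x y; last by rewrite -in_sector_parent// xin mulr1.
    by rewrite xy subnn phi0 mul0r.
  rewrite /wave xin mulr1 subSn// phiSr [phi _ _ + _]addrC addrK.
  rewrite mulrCA mulfV ?q_neq0// mulr1 subrr.
  case: eqVneq => // xpy; move: lyx; rewrite xpy (level_parent htree); lia.
have vx : wave y x = 0 by rewrite /wave (negbTE xout) mulr0.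
have vpx : wave y (parent x) = 0.
  rewrite /wave -[in_sector _ _]negbK; case: (boolP (in_sector y _)) => [xin|];
    last by rewrite mulr0.
  have [xo|xo] := eqVneq x o.
    by rewrite xo (parent_root htree) -xo (negbTE xout) in xin.
  move: (xout); rewrite in_sector_parent ?xin//.
  by apply: contra xout => /eqP ->; exact: in_sector_refl.
rewrite vx vpx subrr subr0.
rewrite (eq_big_seq (fun w => (w == y)%:R)); last first.
  move=> w wx; rewrite /wave (in_sector_ch _ wx) (negbTE xout) /= subr0.
  case: eqVneq => [->|]; last by rewrite mulr0.
  by rewrite subSnn phi1 mulr1.
have [xpy|xpy] := eqVneq x (parent y).
  rewrite (bigD1_seq y)/= ?uniq_ch ?xpy ?ch_parent// eqxx big1 ?addr0// => w.
  by move/negbTE->.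
rewrite big_seq big1// => w wx; case: eqVneq => // wy.
by move: xpy; rewrite -wy (parent_ch wx) eqxx.
Qed.

(** Subtracting the mean over the siblings of [y] cancels the defect. *)
Definition bwave y z : R :=
  wave y z - (q (level y).-1)%:R^-1 * \sum_(w <- ch (parent y)) wave w z.

Lemma balanced_bwave y : y != o -> balanced (bwave y).
Proof.
move=> yo; apply/balancedE => x.
have -> : bwave y = wave y \+ (fun z => - (q (level y).-1)%:R^-1 *
    \sum_(w <- ch (parent y)) wave w z).
  by apply/funext => z; rewrite /bwave /= mulNr.
rewrite defectD defectZ defect_sum wave_defect//.
rewrite (eq_big_seq (fun=> (x == parent y)%:R)); last first.
  by move=> w wy; rewrite wave_defect ?(parent_ch wy)// (ch_neq_root wy).
rewrite sum_ch_cst (level_parent htree) mulrA mulNr mulVf ?q_neq0//.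
by rewrite mulN1r subrr.
Qed.

End RadialTree.

(** * Integrals over finite sets *)

Section DiscreteMeasure.
Context {R : realType} {d : measure_display} {T : measurableType d}.
Variable mu : probability T R.
Hypothesis hdiscrete : forall A : set T, measurable A.
#[local] Hint Extern 0 (measurable _) => solve [exact: hdiscrete] : core.

Lemma measurable_any d' (U : measurableType d') (D : set T) (f : T -> U) : measurable_fun D f.
Proof. by move=> _ Y _; exact: hdiscrete. Qed.

#[local] Hint Extern 0 (measurable_fun _ _) => solve [exact: measurable_any] : core.

Lemma integral_finite_set (s : seq T) (f : T -> R) : uniq s ->
  (\int[mu]_(x in [set` s]) (f x)%:E =
   (\sum_(x <- s) f x * fine (mu [set x]))%:E)%E.
Proof.
elim: s => [_|x s IH /= /andP[xs us]].
  by rewrite set_nil integral_set0 big_nil.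
have -> : [set` x :: s] = [set x] `|` [set` s].
  apply/seteqP; split=> z /=; rewrite inE.
    by case/orP => [/eqP|]; [left|right].
  by case=> [->|->]; rewrite ?eqxx ?orbT.
rewrite integral_setU_EFin//; first last.
- by apply/disj_setPS => z [/= -> zs]; move/negP: xs; apply.
rewrite IH// big_cons EFinD; congr (_ + _)%E.
rewrite (eq_integral (cst (f x)%:E)); last by move=> z; rewrite inE => ->.
by rewrite integral_cst// EFinM fineK// fin_num_measure.
Qed.

End DiscreteMeasure.

(** * Real sequences *)

Section RealSequences.
Variable R : realType.

(** Summing the third hypothesis bounds each partial sum of [B] by [2 * Y] plus
    the next term.  If a partial sum exceeded [2 * Y], all later terms would stay
    above the excess and the partial sums would be unbounded, although they are
    at most [2 * Y + X]. *)
Lemma backward_halving_sum (B D : nat -> R) (X Y : R) :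
  (forall k, 0 <= B k) -> (forall k, B k <= X) ->
  (forall k, B k <= D k + 2^-1 * B k.+1) ->
  (forall n, \sum_(k < n) D k <= Y) -> forall n, \sum_(k < n) B k <= 2 * Y.
Proof.
move=> B0 BX BD DY n.
pose S m := \sum_(k < m) B k.
have SB m : S m <= 2 * Y + B m.
  have : S m <= \sum_(k < m) D k + 2^-1 * \sum_(k < m) B k.+1.
    by rewrite mulr_sumr -big_split/=; apply: ler_sum.
  have : B 0%N + \sum_(k < m) B k.+1 = S m + B m.
    transitivity (\sum_(k < m.+1) B k); first by rewrite big_ord_recl.
    by rewrite big_ord_recr.
  have := DY m; have := B0 0%N; lra.
rewrite leNgt; apply/negP => Sn; rewrite -/(S n) in Sn.
pose eta := S n - 2 * Y.
have eta0 : 0 < eta by rewrite subr_gt0.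
have grow j : S n + j%:R * eta <= S (n + j)%N.
  elim: j => [|j IH]; first by rewrite mul0r addr0 addn0.
  have e : S (n + j.+1)%N = S (n + j)%N + B (n + j)%N by rewrite addnS /S big_ord_recr.
  have := SB (n + j)%N; rewrite e -natr1 mulrDl mul1r.
  have : 0 <= j%:R * eta by rewrite mulr_ge0// ltW.
  rewrite /eta in IH *; lra.
have [j hj] : exists j : nat, X < j%:R * eta.
  exists (Num.bound `|X / eta|); rewrite -ltr_pdivrMr//.
  apply: le_lt_trans (ler_norm _) _.
  exact: archi_boundP.
have := grow j; have := SB (n + j)%N; have := BX (n + j)%N; rewrite /eta in hj *.
by have := eta0; rewrite /eta; lra.
Qed.

End RealSequences.

Lemma norm_1sub_le1 (R : realType) (t : R) : 1 <= t -> t <= 2 -> `|1 - t| <= 1.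
Proof. by move=> t1 t2; rewrite ler_norml; apply/andP; split; lra. Qed.

Lemma sum_sqr_le (R : realType) (a : nat -> R) m n : (forall k, 0 <= a k) ->
  \sum_(m <= k < n) a k ^+ 2 <= (\sum_(m <= k < n) a k) ^+ 2.
Proof.
move=> a0; elim: n => [|n IH]; first by rewrite !big_geq// expr0n.
have [mn|nm] := leqP m n; last by rewrite !big_geq// expr0n.
rewrite !big_nat_recr//= sqrrD lerD2r; apply: (le_trans IH).
by rewrite lerDl mulrn_wge0// mulr_ge0// sumr_ge0.
Qed.

(** * Integration over sectors *)

Section TreeMeasure.
Context {R : realType} {d : measure_display} {T : measurableType d}
  {adj : rel T} {o : T} {q : nat -> nat} {alpha : R} {mu : probability T R} {c : R}.
Hypotheses (hdiscrete : forall A : set T, measurable A)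
  (htree : is_tree adj) (hradial : radial adj o q)
  (hq : forall n, (2 <= q n)%N) (halpha : 1 < alpha) (hc : 0 < c)
  (hmu : forall x, mu [set x] =
     (c * \prod_(l < level adj o x) ((q l)%:R `^ (- alpha)))%:E).

Local Notation level := (level adj o).
Local Notation parent := (parent adj o).
Local Notation sector := (sector adj o).
Local Notation ch := (@ch T adj o).
Local Notation desc := (@desc T adj o).
Local Notation in_sector := (@in_sector T adj o).
Local Notation width := (@width R q).
Local Notation phi := (@phi R q).
Local Notation balanced := (@balanced R T adj o).
Local Notation wave := (@wave R T adj o q).
Local Notation bwave := (@bwave R T adj o q).
Local Notation integT f := (mu.-integrable setT (EFin \o f)).

Implicit Types (f g h b : T -> R).

#[local] Hint Extern 0 (measurable _) => solve [exact: hdiscrete] : core.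
#[local] Hint Extern 0 (measurable_fun _ _) => solve [exact: (measurable_any hdiscrete)] : core.

Definition mass (k : nat) : R := c * \prod_(l < k) ((q l)%:R `^ (- alpha)).

Definition rate : R := 2 `^ (1 - alpha).

Lemma mu_point x : mu [set x] = (mass (level x))%:E.
Proof. exact: hmu. Qed.

Lemma mass_gt0 k : 0 < mass k.
Proof. by rewrite mulr_gt0// prodr_gt0// => l _; rewrite powR_gt0// q_gt0. Qed.

Lemma rate_gt0 : 0 < rate.
Proof. by rewrite powR_gt0. Qed.

Lemma alpha1_gt0 : 0 < alpha - 1.
Proof. by rewrite subr_gt0. Qed.

Lemma rate_lt1 : rate < 1.
Proof.
rewrite /rate -opprB powRN invf_lt1 ?powR_gt0//.
have := @gt0_ltr_powR R _ alpha1_gt0 1 2; rewrite !nnegrE powR1; apply=> //.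
by rewrite ltr1n.
Qed.

(** The masses decay like [q `^ (- alpha)] while the number of children is [q];
    since [alpha > 1], the worst case for the product is [q = 2]. *)
Lemma q_mass k : (q k)%:R * mass k.+1 <= rate * mass k.
Proof.
rewrite /mass big_ord_recr/=; set P := \prod_(_ < k) _.
have -> : (q k)%:R * (c * (P * (q k)%:R `^ (- alpha))) =
    (q k)%:R `^ (1 - alpha) * (c * P).
  rewrite powRD ?q_neq0 ?implybT// powRr1//; ring.
rewrite ler_wpM2r//; first exact/ltW/(mass_gt0 k).
rewrite /rate -opprB !powRN lef_pV2 ?posrE ?powR_gt0// ?q_gt0//.
by apply: ge0_ler_powR; rewrite ?nnegrE ?ler_nat// ltW// alpha1_gt0.
Qed.

Lemma sectorE y : sector y = \bigcup_i [set` desc i y].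
Proof.
apply/seteqP; split=> z.
  move=> /(in_sectorP htree)/(in_sector_desc htree hradial) ?.
  by exists (level z - level y)%N.
by move=> [i _ /= /(desc_in_sector htree hradial)/(in_sectorP htree)].
Qed.

Lemma trivIset_desc y : trivIset setT (fun i => [set` desc i y]).
Proof.
apply/trivIsetP => i j _ _ ij; apply/seteqP; split=> z //= [].
move=> /(level_desc htree hradial)lz /(level_desc htree hradial); rewrite lz => /addnI ij'.
by rewrite ij' eqxx in ij.
Qed.

(** The contribution of generation [i] to the integral of [f] over the sector of [y]. *)
Definition layer (f : T -> R) y i : R :=
  mass (level y + i) * \sum_(z <- desc i y) f z.

Lemma integral_layer f y i :
  (\int[mu]_(x in [set` desc i y]) (f x)%:E = (layer f y i)%:E)%E.
Proof.
rewrite integral_finite_set//; last exact: uniq_desc.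
congr EFin; rewrite /layer mulr_sumr; apply: eq_big_seq => z zy.
by rewrite mu_point (level_desc htree hradial zy) mulrC.
Qed.

Lemma ge0_integral_sector f y : (forall z, 0 <= f z) ->
  (\int[mu]_(x in sector y) (f x)%:E = \sum_(0 <= i <oo) (layer f y i)%:E)%E.
Proof.
move=> f0; rewrite sectorE ge0_integral_bigcup//.
- by apply: eq_eseriesr => i _; exact: integral_layer.
- by move=> x _; rewrite lee_fin.
- exact: trivIset_desc.
Qed.

Lemma layer_ge0 f y i : (forall z, 0 <= f z) -> 0 <= layer f y i.
Proof. by move=> f0; rewrite mulr_ge0 ?sumr_ge0// ltW ?mass_gt0. Qed.

Definition integ y (f : T -> R) := mu.-integrable (sector y) (EFin \o f).

Lemma cvg_layers_ge0 f y : (forall z, 0 <= f z) -> integ y f ->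
  (fun n => \sum_(i < n) layer f y i) @ \oo --> \int[mu]_(x in sector y) f x.
Proof.
move=> f0 fi.
have [_ fin] := integrableP _ _ _ fi.
have Ifin : (\int[mu]_(x in sector y) (f x)%:E)%E \is a fin_num.
  exact: integrable_fin_num.
rewrite /Rintegral; apply: (@fine_cvg _ _ _ _ (fun n => (\sum_(i < n) layer f y i)%:E)).
rewrite fineK// ge0_integral_sector//.
under eq_fun do rewrite -sumEFin -(big_mkord xpredT (fun i => (layer f y i)%:E)).
by apply: is_cvg_nneseries => i _ _; rewrite lee_fin layer_ge0.
Qed.

Lemma integ_abs y f : integ y f -> integ y (fun z => `|f z|).
Proof. by move=> fi; exact: (integrable_norm fi). Qed.

Lemma integD y f g : integ y f -> integ y g -> integ y (fun z => f z + g z).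
Proof. by move=> fi gi; exact: (integrableD (hdiscrete _) fi gi). Qed.

Lemma integZ y a f : integ y f -> integ y (fun z => a * f z).
Proof. by move=> fi; exact: (integrableZl (hdiscrete _) a fi). Qed.

Lemma integN y f : integ y f -> integ y (fun z => - f z).
Proof. by move=> fi; exact: (integrableN fi). Qed.

Lemma integB y f g : integ y f -> integ y g -> integ y (fun z => f z - g z).
Proof. by move=> fi gi; apply: integD => //; exact: integN. Qed.

Lemma integ_le y f g : (forall z, sector y z -> `|f z| <= g z) -> integ y g -> integ y f.
Proof.
move=> fg; apply: le_integrable => //.
by move=> z yz /=; rewrite lee_fin (le_trans (fg z yz))// ler_norm.
Qed.

Lemma integ_cst y a : integ y (fun=> a).
Proof. exact: finite_measure_integrable_cst. Qed.

Lemma integM_bounded y f b B : (forall z, `|b z| <= B) -> integ y f ->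
  integ y (fun z => b z * f z).
Proof.
move=> bB fi; apply: (@integ_le _ _ (fun z => B * `|f z|)); last exact/integZ/integ_abs.
by move=> z _; rewrite normrM ler_wpM2r.
Qed.

(** The integrable case reduces to the nonnegative functions [`|f| + f] and
    [`|f|]. *)
Lemma cvg_layers f y : integ y f ->
  (fun n => \sum_(i < n) layer f y i) @ \oo --> \int[mu]_(x in sector y) f x.
Proof.
move=> fi; have ai := integ_abs fi.
have gi := integD ai fi.
have -> : \int[mu]_(x in sector y) f x =
    \int[mu]_(x in sector y) (`|f x| + f x) - \int[mu]_(x in sector y) `|f x|.
  by rewrite RintegralD// addrC addKr.
have -> : (fun n => \sum_(i < n) layer f y i) =
  (fun n => \sum_(i < n) layer (fun x => `|f x| + f x) y i) \-
  (fun n => \sum_(i < n) layer (fun x => `|f x|) y i).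
  apply/funext => n /=; rewrite -sumrB; apply: eq_bigr => i _.
  by rewrite /layer -mulrBr -sumrB; congr (_ * _); apply: eq_bigr => z _; lra.
apply: cvgB; apply: cvg_layers_ge0 => // z.
by rewrite -lerBlDr sub0r -normrN ler_norm.
Qed.

Lemma sum_layers_le f y n : (forall z, 0 <= f z) -> integ y f ->
  \sum_(i < n) layer f y i <= \int[mu]_(x in sector y) f x.
Proof.
move=> f0 fi; have cv := cvg_layers fi; rewrite -(cvg_lim _ cv)//.
apply: (@nondecreasing_cvgn_le R (fun n => \sum_(i < n) layer f y i)); last exact/cvgP/cv.
apply/nondecreasing_seqP => k; rewrite big_ord_recr lerDl.
exact: layer_ge0.
Qed.

(** Integrability criterion and bound in one: the partial sums over generations
    increase to the integral. *)
Lemma integ_layers f y B : (forall z, 0 <= f z) ->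
  (forall n, \sum_(i < n) layer f y i <= B) ->
  integ y f /\ \int[mu]_(x in sector y) f x <= B.
Proof.
move=> f0 fB.
have le : (\int[mu]_(x in sector y) (f x)%:E <= B%:E)%E.
  rewrite ge0_integral_sector//; apply: lime_le.
    by apply: is_cvg_nneseries => i _ _; rewrite lee_fin layer_ge0.
  by apply: nearW => n; rewrite sumEFin big_mkord lee_fin.
have fi : integ y f.
  apply/integrableP; split=> //.
  apply: le_lt_trans (ltry B); apply: le_trans le.
  by under eq_integral => x _ do rewrite /= ger0_norm//.
split=> //; rewrite -lee_fin /Rintegral fineK//.
exact: integrable_fin_num.
Qed.

Lemma sector_root : sector o = setT.
Proof. by apply/seteqP; split=> z // _; apply/(in_sectorP htree)/in_sector_root. Qed.

Lemma integ_setT f y : mu.-integrable setT (EFin \o f) -> integ y f.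
Proof. by apply: integrableS. Qed.

Lemma sector_ch y w : w \in ch y -> sector w `<=` sector y.
Proof.
move=> wy; rewrite !sectorE => z [i _ /= zw]; exists i.+1 => //=.
by apply/allpairsPdep; exists w, z.
Qed.

Lemma integ_ch y w f : w \in ch y -> integ y f -> integ w f.
Proof. by move=> /sector_ch; apply: integrableS. Qed.

Lemma layerS f y i : layer f y i.+1 = \sum_(w <- ch y) layer f w i.
Proof.
rewrite /layer sum_descS mulr_sumr; apply: eq_big_seq => w wy.
by rewrite (level_ch htree hradial wy) addnS.
Qed.

Lemma layer0 f y : layer f y 0 = mass (level y) * f y.
Proof. by rewrite /layer addn0 sum_desc0. Qed.

Lemma cvgn_unique (u : nat -> R) (a b : R) :
  u @ \oo --> a -> u @ \oo --> b -> a = b.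
Proof. by move=> ua ub; rewrite -(cvg_lim _ ua)// (cvg_lim _ ub). Qed.

Lemma cvg_sum_seq (s : seq T) (u : T -> nat -> R) (l : T -> R) :
  (forall w, w \in s -> u w @ \oo --> l w) ->
  (fun n => \sum_(w <- s) u w n) @ \oo --> \sum_(w <- s) l w.
Proof.
elim: s => [|w s IH] h.
  by rewrite big_nil; under eq_fun do rewrite big_nil; exact: cvg_cst.
rewrite big_cons; under eq_fun do rewrite big_cons.
apply: cvgD; first by apply: h; rewrite inE eqxx.
by apply: IH => z zs; apply: h; rewrite inE zs orbT.
Qed.

(** A sector is its vertex together with the sectors of the children. *)
Lemma integral_step f y : integ y f ->
  \int[mu]_(x in sector y) f x =
  mass (level y) * f y + \sum_(w <- ch y) \int[mu]_(x in sector w) f x.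
Proof.
move=> fi; apply: (@cvgn_unique (fun n => \sum_(i < n.+1) layer f y i)).
  by rewrite (cvg_shiftS (fun n => \sum_(i < n) layer f y i)); exact: cvg_layers.
under eq_fun do rewrite big_ord_recl layer0.
apply: cvgD; first exact: cvg_cst.
under eq_fun => n.
  under eq_bigr => i _ do rewrite layerS.
  rewrite exchange_big/=; over.
by apply: cvg_sum_seq => w wy; apply: cvg_layers; exact: integ_ch fi.
Qed.

Lemma eq_integral_sector f g y : (forall z, in_sector y z -> f z = g z) ->
  \int[mu]_(x in sector y) f x = \int[mu]_(x in sector y) g x.
Proof.
move=> fg; apply: eq_Rintegral => z; rewrite inE => /(in_sectorP htree).
exact: fg.
Qed.

Lemma sum_layer_step (F b : T -> R) y i :
  (forall z, 0 <= F z) ->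
  (forall z w, in_sector y z -> w \in ch z -> F w <= F z + b w) ->
  layer F y i.+1 <= rate * layer F y i + layer b y i.+1.
Proof.
move=> F0 Fb; rewrite /layer !sum_descSr.
rewrite [X in _ <= X + _]mulrA.
apply: (@le_trans _ _ (mass (level y + i.+1) * \sum_(z <- desc i y)
   ((q (level y + i))%:R * F z + \sum_(w <- ch z) b w))).
  rewrite ler_wpM2l ?(ltW (mass_gt0 _))// big_seq [leRHS]big_seq.
  apply: ler_sum => z zy; rewrite -(level_desc htree hradial zy).
  rewrite -(sum_ch_cst hradial) -big_split/= big_seq [leRHS]big_seq.
  by apply: ler_sum => w wz; apply: Fb => //; exact: desc_in_sector zy.
rewrite big_split/= mulrDr lerD2r -mulr_sumr mulrA addnS.
rewrite ler_wpM2r ?sumr_ge0// mulrC; exact: q_mass.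
Qed.

(** Each level carries at most [rate] times the mass of the previous one, so a
    function whose increments along edges are bounded by [b] has an integral
    controlled by that of [b]: summing increments along paths costs nothing but
    a constant. *)
Lemma integral_increments (F b : T -> R) y :
  (forall z, 0 <= F z) -> (forall z, 0 <= b z) -> integ y b ->
  F y <= b y -> (forall z w, in_sector y z -> w \in ch z -> F w <= F z + b w) ->
  integ y F /\
  \int[mu]_(x in sector y) F x <= (1 - rate)^-1 * \int[mu]_(x in sector y) b x.
Proof.
move=> F0 b0 bi Fy Fb; apply: integ_layers => // n.
have r1 : 0 < 1 - rate by rewrite subr_gt0 rate_lt1.
rewrite -ler_pdivrMl ?invr_gt0// invrK.
case: n => [|n].
  by rewrite big_ord0 mulr0; apply: Rintegral_ge0.
apply: le_trans (sum_layers_le n.+1 b0 bi).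
suff : (1 - rate) * \sum_(i < n.+1) layer F y i + rate * layer F y n
    <= \sum_(i < n.+1) layer b y i.
  apply: le_trans; rewrite lerDl mulr_ge0 ?layer_ge0//; exact/ltW/rate_gt0.
elim: n => [|n IH].
  rewrite !big_ord1 !layer0 -mulrDl subrK mul1r.
  by rewrite ler_wpM2l// ltW// mass_gt0.
rewrite big_ord_recr [leRHS]big_ord_recr/=.
have := sum_layer_step n F0 Fb; lra.
Qed.

Definition sector_mass y : R := \int[mu]_(x in sector y) 1.

(** The constant function 1 has no increments beyond the vertex itself, so
    [integral_increments] compares it with the indicator of the vertex. *)
Lemma sector_mass_le y : sector_mass y <= (1 - rate)^-1 * mass (level y).
Proof.
pose b z : R := (z == y)%:R.
have b0 z : 0 <= b z by exact: ler0n.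
have [bi leb] : integ y b /\ \int[mu]_(x in sector y) b x <= mass (level y).
  apply: integ_layers => // n; case: n => [|n].
    by rewrite big_ord0 ltW ?mass_gt0.
  rewrite big_ord_recl layer0 /b eqxx mulr1 big1 ?addr0// => i _.
  rewrite /layer big_seq big1 ?mulr0// => z zy.
  case: eqVneq => // zy'; exfalso; have := level_desc htree hradial zy.
  by rewrite zy' lift0; lia.
have F0 (z : T) : 0 <= (fun=> 1 : R) z by exact: ler01.
have [||_ h] := integral_increments F0 b0 bi.
- by rewrite /b eqxx.
- by move=> z w _ _; rewrite lerDl.
apply: (le_trans h); rewrite ler_wpM2l// invr_ge0 subr_ge0 ltW//.
exact: rate_lt1.
Qed.

Lemma sector_mass_ge y : mass (level y) <= sector_mass y.
Proof.
rewrite /sector_mass (integral_step (integ_cst y 1)) mulr1 lerDl.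
by apply: sumr_ge0 => w _; apply: Rintegral_ge0.
Qed.

Lemma sector_mass_gt0 y : 0 < sector_mass y.
Proof. exact: lt_le_trans (mass_gt0 _) (sector_mass_ge y). Qed.

Lemma sector_massE y : fine (mu (sector y)) = sector_mass y.
Proof. by rewrite /sector_mass Rintegral_cst// mul1r. Qed.

(** * Moments against the harmonic profile *)

Definition profile y z : R := phi (level y) ((level z).+1 - level y).

Lemma profile_ge0 y z : 0 <= profile y z. Proof. exact: phi_ge0. Qed.

Lemma profile_le2 y z : `|profile y z| <= 2.
Proof. by rewrite ger0_norm ?profile_ge0// phi_le2. Qed.

Lemma profile_ge1 y z : in_sector y z -> 1 <= profile y z.
Proof. by case/andP=> l _; rewrite /profile subSn// phiS_ge1. Qed.

Definition energy y : R := \int[mu]_(x in sector y) profile y x ^+ 2.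

Definition moment f y : R := \int[mu]_(x in sector y) (profile y x * f x).

Lemma integ_profile y f : integ y f -> integ y (fun z => profile y z * f z).
Proof. apply: integM_bounded => z; exact: profile_le2. Qed.

Lemma integ_bounded y f B : (forall z, `|f z| <= B) -> integ y f.
Proof.
move=> fB; apply: (integ_le (g := fun=> B)) => //.
exact: integ_cst.
Qed.

(** A balanced function behaves on a sector, against radial weights, like the
    radial function with the same value and increment at the vertex. *)
Lemma integral_radial_balanced (F : nat -> R) B h y : balanced h ->
  (forall n, `|F n| <= B) -> integ y h ->
  \int[mu]_(x in sector y) (F (level x) * h x) =
  h (parent y) * \int[mu]_(x in sector y) F (level x) +
  (h y - h (parent y)) * \int[mu]_(x in sector y) (profile y x * F (level x)).
Proof.
move=> hh FB hi.
have Fi : integ y (fun z => F (level z)) by apply: integ_bounded => z; exact: FB.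
have cv f := @cvg_layers f y.
apply: (cvgn_unique (cv _ _)).
  by apply: integM_bounded hi => z; exact: FB.
have -> : (fun n => \sum_(i < n) layer (fun z => F (level z) * h z) y i) =
   (fun n => h (parent y) * (\sum_(i < n) layer (fun z => F (level z)) y i) +
   (h y - h (parent y)) * (\sum_(i < n) layer (fun z => profile y z * F (level z)) y i)).
  apply/funext => n; rewrite !mulr_sumr -big_split/=; apply: eq_bigr => i _.
  rewrite /layer.
  have lz z : z \in desc i y -> level z = (level y + i)%N.
    exact: level_desc.
  have -> : \sum_(z <- desc i y) F (level z) * h z =
      \sum_(z <- desc i y) F (level y + i)%N * h z.
    by apply: eq_big_seq => z /lz ->.
  have -> : \sum_(z <- desc i y) F (level z) = \sum_(z <- desc i y) F (level y + i)%N.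
    by apply: eq_big_seq => z /lz ->.
  have -> : \sum_(z <- desc i y) profile y z * F (level z) =
      \sum_(z <- desc i y) phi (level y) i.+1 * F (level y + i)%N.
    by apply: eq_big_seq => z /lz lz'; rewrite /profile lz' -addnS addKn.
  rewrite -mulr_sumr (sum_desc_balanced htree hradial hq i y hh) !(sum_desc_cst htree hradial).
  ring.
by apply: cvgD; apply: cvgMr; apply: cv => //; exact: integ_profile.
Qed.

(** Integrals of radial functions over sectors depend only on the level. *)
Lemma integral_radial (F : nat -> R) B y y' : (forall n, `|F n| <= B) ->
  level y = level y' ->
  \int[mu]_(x in sector y) F (level x) = \int[mu]_(x in sector y') F (level x).
Proof.
move=> FB ly.
have Fi w : integ w (fun z => F (level z)) by apply: integ_bounded => z; exact: FB.
have cv f w := @cvg_layers f w.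
apply: (cvgn_unique (cv _ _ (Fi y))).
rewrite (_ : (fun _ => _) = (fun n => \sum_(i < n) layer (fun z => F (level z)) y' i)).
  exact: cv.
apply/funext => n; apply: eq_bigr => i _; rewrite /layer ly.
have E w : level w = level y' -> \sum_(z <- desc i w) F (level z) =
    width (level y') i * F (level y' + i)%N.
  move=> lw; rewrite (eq_big_seq (fun z => F (level y' + i)%N)).
    by rewrite (sum_desc_cst htree hradial) lw.
  by move=> z /(level_desc htree hradial) ->; rewrite lw.
by rewrite !E.
Qed.

(** Siblings have the same energy; this is what makes the coefficients of the
    projection sum to zero over siblings. *)
Lemma energy_level y y' : level y = level y' -> energy y = energy y'.
Proof.
move=> ly; pose F n := phi (level y) (n.+1 - level y) ^+ 2.
have := @integral_radial F 4 y y' _ ly; rewrite /energy /profile -ly; apply.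
move=> n; rewrite normrX [4](_ : _ = 2 ^+ 2); last by rewrite expr2; ring.
by rewrite lerXn2r ?nnegrE// ger0_norm ?phi_le2// phi_ge0.
Qed.

Lemma moment1_level y y' : level y = level y' -> moment (fun=> 1) y = moment (fun=> 1) y'.
Proof.
move=> ly; pose F n := phi (level y) (n.+1 - level y) * 1.
have := @integral_radial F 2 y y' _ ly; rewrite /moment /profile -ly; apply.
by move=> n; rewrite /F mulr1 ger0_norm ?phi_le2// phi_ge0.
Qed.

Lemma sector_mass_level y y' : level y = level y' -> sector_mass y = sector_mass y'.
Proof.
move=> ly; apply: (@integral_radial (fun=> 1) 1 y y') => //.
by move=> n; rewrite normr1.
Qed.

Lemma energy_ge y : sector_mass y <= energy y.
Proof.
apply: le_Rintegral => //; first exact: integ_cst.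
  apply: (@integ_bounded _ _ 4) => z; rewrite normrX [4](_ : _ = 2 ^+ 2); last by rewrite expr2; ring.
  by rewrite lerXn2r ?nnegrE// profile_le2.
move=> z /(in_sectorP htree) yz.
by rewrite expr_ge1 ?profile_ge0// profile_ge1.
Qed.

Lemma energy_gt0 y : 0 < energy y.
Proof.
apply: lt_le_trans (energy_ge y).
exact: sector_mass_gt0.
Qed.

Lemma wave_le2 y z : `|wave y z| <= 2.
Proof.
rewrite /wave normrM -[2]mulr1 ler_pM//; first exact: profile_le2.
by case: in_sector; rewrite ?normr1 ?normr0.
Qed.

Lemma bwave_le4 y z : y != o -> `|bwave y z| <= 4.
Proof.
move=> yo; rewrite /bwave; apply: (le_trans (ler_normB _ _)).
rewrite [4](_ : _ = 2 + 2); last by ring.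
rewrite lerD ?wave_le2// normrM ger0_norm ?invr_ge0// ler_pdivrMl ?(q_gt0 hq)//.
apply: (le_trans (ler_norm_sum _ _ _)).
apply: (@le_trans _ _ (\sum_(w <- ch (parent y)) 2)); last first.
  by rewrite (sum_ch_cst hradial) (level_parent htree).
by apply: ler_sum => w _; exact: wave_le2.
Qed.

Lemma integral_wave f y :
  \int[mu]_z (wave y z * f z) = moment f y.
Proof.
rewrite /moment [RHS]Rintegral_mkcond; apply: eq_Rintegral => z _.
rewrite patchE /wave -/(profile y z).
have -> : (z \in sector y) = in_sector y z.
  by apply/idP/idP => [/set_mem/(in_sectorP htree)//|/(in_sectorP htree)/mem_set].
by case: ifPn; rewrite ?mulr1// mulr0 mul0r.
Qed.

Lemma integTM f g B : (forall z, `|g z| <= B) -> integT f -> integT (fun z => g z * f z).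
Proof.
move=> gB; rewrite -sector_root; exact: integM_bounded.
Qed.

Lemma Rintegral_sum (s : seq T) (F : T -> T -> R) :
  (forall w, w \in s -> integT (F w)) ->
  integT (fun z => \sum_(w <- s) F w z) /\
  \int[mu]_z \sum_(w <- s) F w z = \sum_(w <- s) \int[mu]_z F w z.
Proof.
elim: s => [|w s IH] Fi.
  rewrite big_nil; split.
    rewrite (_ : _ \o _ = EFin \o cst 0); last by apply/funext => z; rewrite /= big_nil.
    exact: finite_measure_integrable_cst.
  under eq_Rintegral do rewrite big_nil.
  by rewrite Rintegral_cst// mul0r.
have [|i1 e1] := IH; first by move=> z zs; apply: Fi; rewrite inE zs orbT.
have Fw : integT (F w) by apply: Fi; rewrite inE eqxx.
rewrite big_cons -e1 -RintegralD//; split; last first.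
  by apply: eq_Rintegral => z _; rewrite big_cons.
rewrite (_ : _ \o _ = (EFin \o F w) \+ (EFin \o (fun z => \sum_(w <- s) F w z)%R))%E.
  exact: integrableD.
by apply/funext => z; rewrite /= big_cons.
Qed.

(** The coefficient of [f] along the increment entering the sector of [y]: the
    functions [e y' * wave y'] over the siblings [y'] of [y], with the [e y']
    summing to zero, form a space on which the orthogonal projection takes the
    moments minus their mean over siblings, divided by the common energy. *)
Definition coef f y : R := (energy y)^-1 *
  (moment f y - (q (level y).-1)%:R^-1 * \sum_(w <- ch (parent y)) moment f w).

Lemma integral_bwave f y : integT f ->
  (energy y)^-1 * \int[mu]_z (bwave y z * f z) = coef f y.
Proof.
move=> fi; rewrite /coef; congr (_ * _).
have wi w : integT (fun z => wave w z * f z) by apply: integTM fi => z; exact: wave_le2.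
have [si se] := @Rintegral_sum (ch (parent y)) (fun w z => wave w z * f z) (fun w _ => wi w).
under [in RHS]eq_bigr do rewrite -integral_wave.
rewrite -integral_wave -se -RintegralZl// -RintegralB//; last exact: (integrableZl (hdiscrete _) _ si).
by apply: eq_Rintegral => z _; rewrite /bwave -mulr_suml; ring.
Qed.

(** * The reproducing kernel *)

(** The increment of the kernel in its first variable at a vertex [x] of level
    [n]: its own wave plus the share [1 / q] of the increment at the parent, as
    required for harmonicity in the first variable.  The recursion is on the
    level because the parent is not structurally smaller. *)
Fixpoint kernel_incr n x z : R :=
  if n is n'.+1 then
    (energy x)^-1 * bwave x z + (q n')%:R^-1 * kernel_incr n' (parent x) z
  else 0.

Fixpoint kernel_rec n x z : R :=
  if n is n'.+1 then kernel_rec n' (parent x) z + kernel_incr n x z else 1.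

Definition kernel x z := kernel_rec (level x) x z.

Definition incr y z := kernel_incr (level y) y z.

Lemma incr_root z : incr o z = 0.
Proof. by rewrite /incr (level_root htree). Qed.

Lemma incr_rec y z : y != o -> incr y z =
  (energy y)^-1 * bwave y z + (q (level (parent y)))%:R^-1 * incr (parent y) z.
Proof. by move=> yo; rewrite /incr {1}(level_rec htree yo). Qed.

Lemma kernel_root z : kernel o z = 1.
Proof. by rewrite /kernel (level_root htree). Qed.

Lemma kernel_parent y z : y != o -> kernel y z = kernel (parent y) z + incr y z.
Proof. by move=> yo; rewrite /kernel /incr (level_rec htree yo). Qed.

Lemma incr_bounded y : exists B, forall z, `|incr y z| <= B.
Proof.
elim/(@level_ind T adj o htree): y => [|y yo [B hB]].
  by exists 0 => z; rewrite incr_root normr0.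
have m0 : 0 <= (energy y)^-1 by rewrite invr_ge0 ltW ?energy_gt0.
have q0 : 0 <= (q (level (parent y)))%:R^-1 :> R by rewrite invr_ge0.
exists ((energy y)^-1 * 4 + (q (level (parent y)))%:R^-1 * B) => z.
rewrite incr_rec//; apply: (le_trans (ler_normD _ _)).
rewrite !normrM (ger0_norm m0) (ger0_norm q0).
by apply: lerD; apply: ler_wpM2l => //; exact: bwave_le4.
Qed.

Lemma kernel_bounded y : exists B, forall z, `|kernel y z| <= B.
Proof.
elim/(@level_ind T adj o htree): y => [|y yo [B hB]].
  by exists 1 => z; rewrite kernel_root normr1.
have [B' hB'] := incr_bounded y.
exists (B + B') => z; rewrite kernel_parent//.
by apply: (le_trans (ler_normD _ _)); rewrite lerD.
Qed.

Lemma balanced_incr y : balanced (incr y).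
Proof.
elim/(@level_ind T adj o htree): y => [|y yo IH]; apply/balancedE => x.
  by rewrite /defect !incr_root subrr subr0 big1// => w _; rewrite !incr_root subrr.
rewrite (_ : incr y = (fun z => (energy y)^-1 * bwave y z) \+
  (fun z => (q (level (parent y)))%:R^-1 * incr (parent y) z)); last first.
  by apply/funext => z; rewrite incr_rec.
rewrite (defectD hradial) !(defectZ hradial).
have e1 := (balancedE _).1 (balanced_bwave htree hradial hq yo).
by have e2 := (balancedE _).1 IH; rewrite e1 e2 !mulr0 addr0.
Qed.

Lemma balanced_kernel y : balanced (kernel y).
Proof.
elim/(@level_ind T adj o htree): y => [|y yo IH]; apply/balancedE => x.
  by rewrite /defect !kernel_root subrr subr0 big1// => w _; rewrite !kernel_root subrr.
rewrite (_ : kernel y = kernel (parent y) \+ incr y); last first.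
  by apply/funext => z; rewrite kernel_parent.
rewrite (defectD hradial).
have e1 := (balancedE _).1 IH.
by have e2 := (balancedE _).1 (balanced_incr y); rewrite e1 e2 addr0.
Qed.

(** The value at [y] of the increment of the projection of [f], see
    [proj_incr]. *)
Definition incr_op f y := \int[mu]_z (incr y z * f z).

Definition proj f y := \int[mu]_z (kernel y z * f z).

Lemma incr_op_root f : incr_op f o = 0.
Proof.
rewrite /incr_op; under eq_Rintegral do rewrite incr_root mul0r.
by rewrite Rintegral_cst// mul0r.
Qed.

Lemma incr_op_rec f y : integT f -> y != o -> incr_op f y =
  coef f y + (q (level (parent y)))%:R^-1 * incr_op f (parent y).
Proof.
move=> fi yo; have [B hB] := incr_bounded (parent y).
have i1 : integT (fun z => incr (parent y) z * f z) by apply: integTM fi.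
have i2 : integT (fun z => bwave y z * f z).
  by apply: integTM fi => z; exact: bwave_le4.
rewrite -integral_bwave// -!RintegralZl//.
rewrite -RintegralD//;
  [|exact: (integrableZl (hdiscrete _) _ i2)|exact: (integrableZl (hdiscrete _) _ i1)].
by apply: eq_Rintegral => z _; rewrite incr_rec//; ring.
Qed.

Lemma proj_root f : proj f o = \int[mu]_z f z.
Proof. by apply: eq_Rintegral => z _; rewrite kernel_root mul1r. Qed.

Lemma proj_rec f y : integT f -> y != o -> proj f y = proj f (parent y) + incr_op f y.
Proof.
move=> fi yo; have [B hB] := incr_bounded y.
have [B' hB'] := kernel_bounded (parent y).
rewrite -RintegralD//; [|exact: integTM fi|exact: integTM fi].
by apply: eq_Rintegral => z _; rewrite kernel_parent//; ring.
Qed.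

Lemma proj_incr f y : integT f -> proj f y - proj f (parent y) = incr_op f y.
Proof.
move=> fi; have [->|yo] := eqVneq y o.
  by rewrite (parent_root htree) incr_op_root subrr.
by rewrite proj_rec// addrC addKr.
Qed.

Lemma sum_coef f x : \sum_(y <- ch x) coef f y = 0.
Proof.
rewrite big_seq.
have [y0 y0x] : exists y0, y0 \in ch x.
  have : (0 < size (ch x))%N by rewrite (size_ch hradial) (leq_trans _ (hq _)).
  by case: (ch x) => // y0 s _; exists y0; rewrite inE eqxx.
have ly0 := level_ch htree hradial y0x.
rewrite (eq_bigr (fun y => (energy y0)^-1 * (moment f y -
    (q (level x))%:R^-1 * \sum_(w <- ch x) moment f w))); last first.
  move=> y yx; rewrite /coef (parent_ch htree hradial yx) (level_ch htree hradial yx) /=.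
  by rewrite (@energy_level y y0)// ly0 (level_ch htree hradial yx).
rewrite -big_seq -mulr_sumr sumrB (sum_ch_cst hradial) mulrA mulfV ?q_neq0//.
by rewrite mul1r subrr mulr0.
Qed.

Lemma balanced_proj f : integT f -> balanced (proj f).
Proof.
move=> fi x; rewrite proj_incr//.
rewrite (eq_big_seq (fun y => coef f y + (q (level x))%:R^-1 * incr_op f x)).
  rewrite big_split/= sum_coef add0r (sum_ch_cst hradial) mulrA mulfV ?q_neq0//.
  by rewrite mul1r.
move=> y yx; rewrite -[in proj f x](parent_ch htree hradial yx) proj_incr//.
by rewrite incr_op_rec// ?(ch_neq_root htree hradial yx)// (parent_ch htree hradial yx).
Qed.

(** The two functionals [moment (fun=> 1)] and [energy] are the coordinates of
    the moment of a balanced function. *)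
Lemma moment_balanced h y : balanced h -> integT h -> moment h y =
  h (parent y) * moment (fun=> 1) y + (h y - h (parent y)) * energy y.
Proof.
move=> hh hi; have hy := integ_setT y hi.
rewrite /moment.
have := @integral_radial_balanced (fun n => phi (level y) (n.+1 - level y)) 2 h y hh _ hy.
rewrite -/(profile y _) => ->; last by move=> n; rewrite ger0_norm ?phi_ge0// phi_le2.
congr (_ * _ + _ * _); apply: eq_Rintegral => z _; first by rewrite mulr1.
Qed.

(** The mean value property: [parent o = o] makes the increment at the root
    vanish in [integral_radial_balanced]. *)
Lemma mean_balanced h : balanced h -> integT h -> \int[mu]_z h z = h o.
Proof.
move=> hh hi; have ho := integ_setT o hi.
have B (n : nat) : `|(fun=> 1 : R) n| <= 1 :> R by rewrite normr1.
have := integral_radial_balanced hh B ho.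
rewrite sector_root (parent_root htree) subrr mul0r addr0 /=.
have -> : \int[mu]_x 1 = 1 :> R.
  rewrite Rintegral_cst// mul1r -[RHS]/(fine 1%E); congr fine.
  exact: probability_setT.
rewrite mulr1 => <-.
by apply: eq_Rintegral => z _; rewrite mul1r.
Qed.

(** The value of [h] at the parent enters all siblings alike and is removed by
    subtracting the mean; the mean of the increments is computed by balance. *)
Lemma coef_balanced h y : balanced h -> integT h -> y != o ->
  coef h y = h y - h (parent y) -
    (q (level (parent y)))%:R^-1 * (h (parent y) - h (parent (parent y))).
Proof.
move=> hh hi yo; rewrite /coef.
have lp := level_parent htree y.
rewrite (eq_big_seq (fun w => h (parent y) * moment (fun=> 1) y +
    (h w - h (parent y)) * energy y)); last first.
  move=> w wy; rewrite moment_balanced// (parent_ch htree hradial wy).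
  have lw : level w = level y.
    by rewrite (level_ch htree hradial wy) -(level_rec htree yo).
  by rewrite (moment1_level lw) (energy_level lw).
rewrite moment_balanced// big_split/= (sum_ch_cst hradial) -mulr_suml hh -lp.
have := q_neq0 (R := R) hq (level (parent y)).
have := energy_gt0 y; move: (q _)%:R (energy y) (moment _ _) => a b m b0 a0.
by field; rewrite a0 gt_eqF.
Qed.

Lemma incr_op_balanced h y : balanced h -> integT h -> incr_op h y = h y - h (parent y).
Proof.
move=> hh hi; elim/(@level_ind T adj o htree): y => [|y yo IH].
  by rewrite incr_op_root (parent_root htree) subrr.
by rewrite incr_op_rec// IH coef_balanced// subrK.
Qed.

(** The reproducing property of [kernel]. *)
Lemma proj_balanced h y : balanced h -> integT h -> proj h y = h y.
Proof.
move=> hh hi; elim/(@level_ind T adj o htree): y => [|y yo IH].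
  by rewrite proj_root mean_balanced.
by rewrite proj_rec// IH incr_op_balanced// addrC subrK.
Qed.

(** Single vertices have positive mass, so that essential suprema are
    suprema. *)
Lemma ae_point (P : T -> Prop) z : (\forall x \ae mu, P x) -> P z.
Proof.
move=> [N [mN N0 PN]]; apply: contrapT => nP.
have : (mu [set z] <= mu N)%E by apply: le_measure; rewrite ?inE// => w ->; exact: PN.
rewrite N0 hmu lee_fin leNgt => /negP; apply.
exact: mass_gt0.
Qed.

Lemma mu_setT_gt0 : (0 < mu setT)%E.
Proof. by rewrite probability_setT lte01. Qed.

Lemma Lnorm_infty_ge f z : (`|f z|%:E <= 'N[mu]_+oo[EFin \o f])%E.
Proof.
rewrite unlock /= mu_setT_gt0.
exact: (ae_point z (ess_sup_ge mu (abse \o (EFin \o f)))).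
Qed.

Lemma Lnorm_infty_le f B : (forall z, `|f z| <= B) -> ('N[mu]_+oo[EFin \o f] <= B%:E)%E.
Proof.
move=> fB; rewrite unlock /= mu_setT_gt0.
by apply/ess_supP; apply: nearW => z /=; rewrite lee_fin.
Qed.

Lemma Lfun2_bounded f B : (forall z, `|f z| <= B) -> f \in Lfun mu 2%:E.
Proof.
move=> fB; apply: (@Lfun_subset _ _ _ mu 2%:E +oo%E); rewrite ?leey ?lee1n//.
  exact: fin_num_measure.
rewrite inE; apply/andP; split; rewrite inE//=.
by rewrite /finite_norm (le_lt_trans (Lnorm_infty_le fB))// ltry.
Qed.

Lemma point_le f z : (forall x, 0 <= f x) -> integT f ->
  mass (level z) * f z <= \int[mu]_x f x.
Proof.
move=> f0 fi; have io := integ_setT o fi.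
have := sum_layers_le (level z).+1 f0 io.
rewrite sector_root; apply: le_trans.
rewrite big_ord_recr/= -[leLHS]add0r lerD//.
  by apply: sumr_ge0 => i _; exact: layer_ge0.
rewrite /layer (level_root htree) add0n.
apply: ler_wpM2l; first exact/ltW/mass_gt0.
have zin : z \in desc (level z) o.
  have := in_sector_desc htree hradial (in_sector_root (o := o) htree z).
  by rewrite (level_root htree) subn0.
rewrite (bigD1_seq z zin)/=; last exact: uniq_desc.
by rewrite lerDl; apply: sumr_ge0.
Qed.

(** Existence is the reproducing property of [kernel].  For uniqueness, the
    difference of two reproducing functions lies in the Bergman space, is
    orthogonal to it, and hence has norm zero; it vanishes because every vertex
    has positive mass. *)
Lemma bergman_kernelE x : bergman_kernel adj mu x = kernel x.
Proof.
have kb y : bergman adj mu (kernel y).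
  split; last by apply/(harmonicP htree hradial hq)/balanced_kernel.
  by have [B] := kernel_bounded y; exact: Lfun2_bounded.
have Lint h : h \in Lfun mu 2%:E -> integT h.
  by move=> h2; apply/Lfun1_integrable/Lfun_subset12 => //; exact: fin_num_measure.
have kr h : bergman adj mu h -> h x = \int[mu]_y (kernel x y * h y).
  move=> [h2 /(harmonicP htree hradial hq) hh].
  by rewrite -[RHS]/(proj h x) proj_balanced//; exact: Lint.
have [[k2 kh] krep] : (bergman adj mu (bergman_kernel adj mu x) /\
   forall h, bergman adj mu h -> h x = \int[mu]_y (bergman_kernel adj mu x y * h y)).
  apply: (@xgetPex _ (cst 0) [set k | bergman adj mu k /\ _]).
  by exists (kernel x).
set k := bergman_kernel adj mu x in k2 kh krep *.
pose h := k - kernel x.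
have hb : bergman adj mu h.
  split.
    rewrite (_ : h = -1 *: kernel x + k); last by rewrite scaleN1r addrC.
    have le12 : (1 <= 2%:E :> \bar R)%E by rewrite lee1n.
    exact: ((Lfun_submod_closed mu le12).2 _ _ _ (kb x).1 k2).
  apply/(harmonicP htree hradial hq)/balancedE => z.
  rewrite (_ : h = k \+ (fun z => -1 * kernel x z)); last first.
    by apply/funext => w; rewrite /h /= mulN1r.
  rewrite (defectD hradial) (defectZ hradial).
  have /(harmonicP htree hradial hq) kh' := kh.
  by rewrite (balancedE _).1// (balancedE _).1 ?mulr0 ?addr0//; exact: balanced_kernel.
have h2 := hb.1.
have i1 : integT (fun y => k y * h y) by apply/Lfun1_integrable; exact: Lfun2_mul_Lfun1.
have i2 : integT (fun y => kernel x y * h y).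
  by apply/Lfun1_integrable; apply: Lfun2_mul_Lfun1 => //; exact: (kb x).1.
have hsq : \int[mu]_y (h y ^+ 2) = 0.
  rewrite -[RHS](subrr (h x)) {1}(krep h hb) (kr h hb) -RintegralB//.
  by apply: eq_Rintegral => y _; rewrite -mulrBl expr2.
apply/funext => z; apply/eqP; rewrite -subr_eq0 -[_ - _]/(h z) -sqrf_eq0.
have h0 y : 0 <= h y ^+ 2 by exact: sqr_ge0.
have := point_le z h0 (Lfun2_integrable_sqr h2).
rewrite hsq pmulr_rle0 ?mass_gt0// => hz.
by rewrite eq_le hz h0.
Qed.

Lemma bergman_projectorE f : bergman_projector adj mu f = proj f.
Proof. by apply/funext => x; rewrite /bergman_projector bergman_kernelE. Qed.

(** * Dyadic averages and the square function *)

Local Notation cexp := (cexp adj o mu).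
Local Notation mdiff := (mdiff adj o mu).
Local Notation avg f y := (average mu f (sector y)).

(** The ancestor of [z] at level [k]; meaningful for [k <= level z]. *)
Definition anc k z := iter (level z - k) parent z.

Lemma average_point f x : average mu f [set x] = f x.
Proof.
rewrite /average (_ : \int[mu]_(z in [set x]) f z = \int[mu]_(z in [set x]) f x).
  rewrite Rintegral_cst// mulrC mulfK// gt_eqF// -[ltRHS]/(fine (mu [set x])) hmu/=.
  exact: mass_gt0.
by apply: eq_Rintegral => z; rewrite inE => ->.
Qed.

(** Exactly one dyadic set of generation [k] contains [x], so that the sum over
    the infinite family has a single nonzero term. *)
Lemma cexpE k f x : cexp k f x = if (level x < k)%N then f x else avg f (anc k x).
Proof.
rewrite /Defs.cexp.
pose Q0 := if (level x < k)%N then [set x] else sector (anc k x).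
have xQ0 : Q0 x.
  rewrite /Q0; case: ltnP => // kx; apply/(in_sectorP htree).
  rewrite /in_sector (level_iter_parent htree) subKn// /anc eqxx andbT.
  exact: kx.
have uQ Q : dyadic adj o k Q -> Q x -> Q = Q0.
  move=> [[z /= lz <-]|[y /= ly <-]].
    by move=> /= xz; rewrite /Q0 xz lz.
  move=> /(in_sectorP htree) /andP[lyx /eqP yx]; rewrite /Q0 -ly ltnNge lyx /=.
  by rewrite /anc yx.
have dQ0 : dyadic adj o k Q0.
  rewrite /Q0; case: ltnP => kx; [left; exists x => //|right; exists (anc k x) => //].
  by rewrite /= (level_iter_parent htree) subKn.
rewrite -(@fsbig_widen _ _ _ _ [set Q0])/=; last 2 first.
- by move=> _ ->.
- move=> Q [dQ QQ0]; rewrite /= indicE memNset ?mulr0// => Qx.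
  by apply: QQ0; exact: uQ.
rewrite fsbig_set1 indicE mem_set// mulr1 /Q0.
by case: ltnP => // _; exact: average_point.
Qed.

Definition jump f y := avg f y - avg f (parent y).

Lemma jump_root f : jump f o = 0.
Proof. by rewrite /jump (parent_root htree) subrr. Qed.

Lemma anc_level z : anc (level z) z = z.
Proof. by rewrite /anc subnn. Qed.

Lemma anc_parent k z : (k < level z)%N -> anc k z = anc k (parent z).
Proof.
move=> kz; rewrite /anc (level_parent htree).
have -> : (level z - k = ((level z).-1 - k).+1)%N by lia.
by rewrite iterSr.
Qed.

Lemma parent_anc k z : (k < level z)%N -> parent (anc k.+1 z) = anc k z.
Proof.
move=> kz; rewrite /anc.
by have -> : (level z - k = (level z - k.+1).+1)%N by lia.
Qed.

(** At [z] the martingale differences of order [1 .. level z] are the jumps at the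
    ancestors of [z]; the next one compares [f z] with its sector average, and
    the later ones vanish. *)
Lemma mdiff_level f z : (0 < level z)%N -> mdiff (level z) f z = jump f z.
Proof.
move=> lz; rewrite /Defs.mdiff !cexpE ltnn anc_level.
have -> : (level z < (level z).-1)%N = false by lia.
by rewrite -parent_anc ?prednK ?anc_level.
Qed.

Lemma mdiff_next f z : mdiff (level z).+1 f z = f z - avg f z.
Proof. by rewrite /Defs.mdiff !cexpE ltnSn ltnn anc_level. Qed.

Lemma mdiff_far k f z : (level z < k.-1)%N -> mdiff k f z = 0.
Proof.
move=> lz; rewrite /Defs.mdiff !cexpE lz (leq_trans lz (leq_pred _)).
by rewrite subrr.
Qed.

Lemma mdiff_parent k f z : (k < level z)%N -> mdiff k f z = mdiff k f (parent z).
Proof.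
move=> kz; have lp := level_parent htree z.
rewrite /Defs.mdiff !cexpE lp.
have -> : (level z < k)%N = false by lia.
have -> : (level z < k.-1)%N = false by lia.
have -> : ((level z).-1 < k)%N = false by lia.
have -> : ((level z).-1 < k.-1)%N = false by lia.
by rewrite !(anc_parent (z := z))//; exact: leq_ltn_trans (leq_pred _) kz.
Qed.

Local Notation sqf := (square_function adj o mu).

Lemma sqf_ge0 f z : (0 <= sqf f z)%E.
Proof. exact: poweR_ge0. Qed.

Lemma h1_normE f : h1_norm adj o mu f = (\int[mu]_z sqf f z)%E.
Proof.
rewrite /h1_norm Lnorm1; apply: eq_integral => z _.
by rewrite gee0_abs// sqf_ge0.
Qed.

Lemma poweR_half_sqr (a : R) : 0 <= a -> ((a ^+ 2)%:E `^ 2^-1 = a%:E)%E.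
Proof. by move=> a0; rewrite poweR_EFin powR12_sqrt ?sqr_ge0// sqrtr_sqr ger0_norm. Qed.

Lemma poweR_half_le (x y : \bar R) : (0 <= x)%E -> (x <= y)%E -> (x `^ 2^-1 <= y `^ 2^-1)%E.
Proof.
move=> x0 xy; apply: gt0_ler_poweR => //.
- by rewrite in_itv/= x0 leey.
- by rewrite in_itv/= (le_trans x0 xy) leey.
Qed.

Lemma sqf_ge_mdiff k f z : (0 < k)%N -> (`|mdiff k f z|%:E <= sqf f z)%E.
Proof.
move=> k0; rewrite -poweR_half_sqr//; apply: poweR_half_le.
  by rewrite lee_fin sqr_ge0.
have a0 n : (0 <= (`|mdiff n f z| ^+ 2)%R%:E :> \bar R)%E by rewrite lee_fin sqr_ge0.
apply: le_trans (nneseries_lim_ge k.+1 (fun n _ _ => a0 n)).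
rewrite big_nat_recr//= leeDr//.
by apply: sume_ge0.
Qed.

Lemma sqf_ge_jump f z : (`|jump f z|%:E <= sqf f z)%E.
Proof.
have [->|zo] := eqVneq z o; first by rewrite jump_root normr0 sqf_ge0.
have lz : (0 < level z)%N by rewrite lt0n (level_eq0 htree).
by rewrite -mdiff_level// sqf_ge_mdiff.
Qed.

Lemma h1_norm_ge0 f : (0 <= h1_norm adj o mu f)%E.
Proof. exact: Lnorm_ge0. Qed.

(** A single difference is bounded by the square function, and [jump f z] is the
    one that is constant on the sector of [z]. *)
Lemma h1_norm_jump f : (h1_norm adj o mu f < +oo)%E ->
  integT (jump f) /\ \int[mu]_z `|jump f z| <= fine (h1_norm adj o mu f).
Proof.
move=> fin.
have le : (\int[mu]_z (`|jump f z|)%:E <= h1_norm adj o mu f)%E.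
  rewrite h1_normE; apply: ge0_le_integral => // z _; exact: sqf_ge_jump.
have ji : integT (jump f).
  by apply/integrableP; split=> //; exact: le_lt_trans le fin.
split=> //; rewrite /Rintegral fine_le//.
- exact/integrable_fin_num/integrable_norm.
- by rewrite ge0_fin_numE// h1_norm_ge0.
Qed.

(** * Moments of a function and its jumps *)

Lemma subr_rate_gt0 : 0 < 1 - rate.
Proof. by rewrite subr_gt0 rate_lt1. Qed.

#[local] Hint Resolve mass_gt0 sector_mass_gt0 energy_gt0 subr_rate_gt0 : core.

Lemma avgE f y : avg f y = (sector_mass y)^-1 * \int[mu]_(x in sector y) f x.
Proof. by rewrite /average sector_massE. Qed.

Lemma integral_avg f y : \int[mu]_(x in sector y) f x = sector_mass y * avg f y.
Proof. by rewrite avgE mulrA mulfV ?mul1r// gt_eqF. Qed.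

Lemma profile_ch y w z : w \in ch y -> in_sector w z ->
  profile y z = 1 + (q (level y))%:R^-1 * profile w z.
Proof.
move=> wy /andP[lwz _]; rewrite /profile (level_ch htree hradial wy) in lwz *.
have -> : ((level z).+1 - level y = ((level z).+1 - (level y).+1).+1)%N by lia.
by rewrite phiSl.
Qed.

Lemma profile_refl y : profile y y = 1.
Proof. by rewrite /profile subSnn phi1. Qed.

Lemma moment_step f y : integ y f -> moment f y =
  \int[mu]_(x in sector y) f x + (q (level y))%:R^-1 * \sum_(w <- ch y) moment f w.
Proof.
move=> fi; rewrite /moment !integral_step//; last exact: integ_profile.
rewrite profile_refl mul1r -addrA; congr (_ + _).
rewrite mulr_sumr -big_split/=; apply: eq_big_seq => w wy.
have fw : integ w f by apply: (integ_ch wy).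
have pw : integ w (fun z => profile w z * f z) by exact: integ_profile.
rewrite -RintegralZl// -RintegralD//; last exact: integZ.
apply: eq_integral_sector => z wz.
by rewrite (profile_ch wy wz); ring.
Qed.

(** The moment on the sector of [y] of [f] minus its average over the sector of
    the parent.  The subtracted constant is common to all siblings and cancels
    in [coef]. *)
Definition moment_dev f y := moment f y - avg f (parent y) * moment (fun=> 1) y.

Lemma moment1_ge0 y : 0 <= moment (fun=> 1) y.
Proof. by apply: Rintegral_ge0 => z _; rewrite mulr1; exact: profile_ge0. Qed.

Lemma abs_moment_le f y : integ y f ->
  `|moment f y| <= 2 * \int[mu]_(x in sector y) `|f x|.
Proof.
move=> fi; have pi := integ_profile fi.
apply: (le_trans (le_normr_Rintegral _ pi)) => //.
rewrite -RintegralZl//; last exact: integ_abs.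
apply: le_Rintegral => //; [exact: integ_abs|exact/integZ/integ_abs|].
by move=> z _; rewrite normrM ler_wpM2r// profile_le2.
Qed.

Lemma moment1_le y : moment (fun=> 1) y <= 2 * sector_mass y.
Proof.
have := abs_moment_le (integ_cst y 1).
rewrite ger0_norm ?moment1_ge0// => /le_trans; apply.
rewrite ler_wpM2l//; apply: le_Rintegral => //; [exact/integ_abs/integ_cst|exact: integ_cst|].
by move=> z _; rewrite normr1.
Qed.

Lemma abs_moment_dev_le f y : integ y f ->
  `|moment_dev f y| <= 2 * \int[mu]_(x in sector y) `|f x - avg f (parent y)|.
Proof.
move=> fi; set a := avg _ _.
have ci : integ y (fun=> 1) by exact: integ_cst.
have -> : moment_dev f y = moment (fun x => f x - a) y.
  rewrite /moment_dev -/a /moment -RintegralZl//; last exact: integ_profile.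
  rewrite -RintegralB//; [|exact: integ_profile|exact/integZ/integ_profile].
  by apply: eq_Rintegral => z _; ring.
apply: abs_moment_le; apply: integB => //; exact: integ_cst.
Qed.

(** On the sector of a child the profile of [y] is [1] plus [1 / q] times the
    profile of the child ([profile_ch]), and changing the reference average from
    the parent of [y] to [y] itself costs [jump f y]. *)
Lemma moment_dev_step f y : integ y f -> moment_dev f y =
  jump f y * moment (fun=> 1) y +
  (q (level y))%:R^-1 * \sum_(w <- ch y) moment_dev f w.
Proof.
move=> fi; have ci : integ y (fun=> 1) by exact: integ_cst.
have -> : \sum_(w <- ch y) moment_dev f w =
    \sum_(w <- ch y) moment f w - avg f y * \sum_(w <- ch y) moment (fun=> 1) w.
  rewrite mulr_sumr -sumrB; apply: eq_big_seq => w wy.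
  by rewrite /moment_dev (parent_ch htree hradial wy).
rewrite /moment_dev /jump (moment_step fi) (moment_step ci) integral_avg -/(sector_mass y).
ring.
Qed.

Lemma sum_ch_integral f y : (forall z, 0 <= f z) -> integ y f ->
  \sum_(w <- ch y) \int[mu]_(x in sector w) f x <= \int[mu]_(x in sector y) f x.
Proof.
move=> f0 fi; rewrite integral_step// lerDr mulr_ge0//; exact/ltW.
Qed.

Lemma sum_desc_integral f k : (forall z, 0 <= f z) -> integT f ->
  \sum_(y <- desc k o) \int[mu]_(x in sector y) f x <= \int[mu]_x f x.
Proof.
move=> f0 fi; have fy y : integ y f by exact: integ_setT.
elim: k => [|k IH]; first by rewrite sum_desc0 sector_root.
apply: le_trans IH; rewrite sum_descSr; apply: ler_sum => y _.
exact: sum_ch_integral.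
Qed.

Lemma sector_mass_avg f y : integ y f ->
  sector_mass y * `|avg f y| <= \int[mu]_(x in sector y) `|f x|.
Proof.
move=> fi; rewrite -[X in X * _](ger0_norm (ltW (sector_mass_gt0 y))) -normrM -integral_avg.
exact: (le_normr_Rintegral (hdiscrete _) fi).
Qed.

(** A bound that is uniform in the generation but too weak to be summed:
    it supplies the constant [X] of [backward_halving_sum] and does not enter
    the final estimate. *)
Lemma sum_moment_dev_bounded f k : integT f ->
  \sum_(y <- desc k o) `|moment_dev f y| <= 4 * \int[mu]_x `|f x|.
Proof.
move=> fi; have fy y : integ y f by exact: integ_setT.
have ai y : integ y (fun z => `|f z|) by exact: integ_abs.
have aT : integT (fun z => `|f z|) by exact: integrable_norm.
have le y : `|moment_dev f y| <= 2 * \int[mu]_(x in sector y) `|f x| +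
    2 * (sector_mass y * `|avg f (parent y)|).
  apply: (le_trans (ler_normB _ _)); rewrite lerD ?abs_moment_le//.
  rewrite normrM mulrC (ger0_norm (moment1_ge0 y)) mulrA ler_wpM2r//.
  exact: moment1_le.
apply: (@le_trans _ _ (2 * \sum_(y <- desc k o) \int[mu]_(x in sector y) `|f x| +
   2 * \sum_(y <- desc k o) (sector_mass y * `|avg f (parent y)|))).
  by rewrite !mulr_sumr -big_split/=; apply: ler_sum.
rewrite [leRHS](_ : _ = 2 * \int[mu]_x `|f x| + 2 * \int[mu]_x `|f x|); last by ring.
apply: lerD; apply: ler_wpM2l => //; first exact: sum_desc_integral.
case: k => [|k].
  rewrite sum_desc0 (parent_root htree); apply: (le_trans (sector_mass_avg (fy o))).
  by rewrite sector_root.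
apply: le_trans (sum_desc_integral k (fun z => normr_ge0 (f z)) aT).
rewrite sum_descSr; apply: ler_sum => y _; apply: le_trans (sector_mass_avg (fy y)).
rewrite (eq_big_seq (fun w => sector_mass w * `|avg f y|)); last first.
  by move=> w wy; rewrite (parent_ch htree hradial wy).
rewrite -mulr_suml ler_wpM2r//.
by apply: sum_ch_integral => //; exact: integ_cst.
Qed.

Definition Cdev : R := 4 / (1 - rate).

(** In [moment_dev_step] the factor [1 / q] is at most one half, so summing
    [moment_dev] over a generation gives the hypothesis of
    [backward_halving_sum]. *)
Lemma sum_moment_dev_le f n : integT f -> integT (jump f) ->
  \sum_(k < n) \sum_(y <- desc k o) `|moment_dev f y| <=
  Cdev * \int[mu]_z `|jump f z|.
Proof.
move=> fi ji; have fy y : integ y f by exact: integ_setT.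
have jo : integ o (fun z => `|jump f z|) by apply: integ_setT => //; exact: integrable_norm.
rewrite [leRHS](_ : _ = 2 * (2 / (1 - rate) * \int[mu]_z `|jump f z|)); last first.
  by rewrite /Cdev; ring.
apply: (@backward_halving_sum R
  (fun k => \sum_(y <- desc k o) `|moment_dev f y|)
  (fun k => 2 / (1 - rate) * layer (fun z => `|jump f z|) o k)
  (4 * \int[mu]_x `|f x|) (2 / (1 - rate) * \int[mu]_z `|jump f z|)).
- by move=> k; apply: sumr_ge0.
- by move=> k; exact: sum_moment_dev_bounded.
- move=> k; rewrite /layer sum_descSr !mulr_sumr -big_split/=.
  rewrite big_seq [leRHS]big_seq; apply: ler_sum => y yk.
  rewrite {1}moment_dev_step//; apply: (le_trans (ler_normD _ _)); apply: lerD.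
    rewrite normrM (ger0_norm (moment1_ge0 y)) mulrC mulrA ler_wpM2r//.
    apply: (le_trans (moment1_le y)); rewrite -mulrA ler_wpM2l//.
    rewrite (level_root htree) add0n -(addn0 k).
    have := sector_mass_le y.
    by rewrite (level_desc htree hradial yk) (level_root htree) add0n addn0.
  rewrite normrM ler_pM//; last exact: ler_norm_sum.
  by rewrite ger0_norm ?invr_ge0// qV_le_half.
- move=> m; rewrite -mulr_sumr ler_wpM2l//; first by rewrite divr_ge0// ltW.
  have := sum_layers_le m (fun z => normr_ge0 (jump f z)) jo.
  by rewrite sector_root.
Qed.

(** The moment of 1 is the same for all siblings, so that subtracting the mean
    over siblings removes the reference average. *)
Lemma moment_dev_sib f y : y != o -> moment f y -
   (q (level y).-1)%:R^-1 * \sum_(w <- ch (parent y)) moment f w =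
   moment_dev f y -
   (q (level y).-1)%:R^-1 * \sum_(w <- ch (parent y)) moment_dev f w.
Proof.
move=> yo; have lp := level_parent htree y.
rewrite [X in _ = _ - _ * X](eq_big_seq (fun w => moment f w -
    avg f (parent y) * moment (fun=> 1) y)); last first.
  move=> w wy; rewrite /moment_dev (parent_ch htree hradial wy).
  congr (_ - _ * _); apply: moment1_level.
  by rewrite (level_ch htree hradial wy) -(level_rec htree yo).
rewrite sumrB (sum_ch_cst hradial) lp /moment_dev.
by have c0 := q_neq0 (R := R) hq (level y).-1; field.
Qed.

Lemma abs_coef_le f y : y != o -> `|coef f y| <= (energy y)^-1 *
  (`|moment_dev f y| + (q (level y).-1)%:R^-1 * \sum_(w <- ch (parent y)) `|moment_dev f w|).
Proof.
move=> yo; have n0 : 0 <= (energy y)^-1 by rewrite invr_ge0 (ltW (energy_gt0 y)).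
have q0 : 0 <= (q (level y).-1)%:R^-1 :> R by rewrite invr_ge0.
rewrite /coef moment_dev_sib// normrM (ger0_norm n0); apply: ler_wpM2l => //.
apply: (le_trans (ler_normB _ _)); rewrite lerD2l normrM (ger0_norm q0).
by apply: ler_wpM2l => //; exact: ler_norm_sum.
Qed.

(** The energy is at least the mass of the vertex, so the weighted sum of the
    coefficients over a family of siblings is at most twice that of the moments.
    [b] vanishes at the root because no increment enters there. *)
Lemma integral_coef_le f : integT f -> integT (jump f) ->
  let b z := if z == o then 0 else `|coef f z| in
  integ o b /\ \int[mu]_z b z <= 2 * (Cdev * \int[mu]_z `|jump f z|).
Proof.
move=> fi ji b; have b0 z : 0 <= b z by rewrite /b; case: ifP.
set J := \int[mu]_z `|jump f z|.
rewrite -sector_root.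
apply: (integ_layers b0) => n.
apply: le_trans (ler_wpM2l (ler0n _ 2) (sum_moment_dev_le n fi ji)).
rewrite mulr_sumr; apply: ler_sum => -[i _] _ /=.
case: i => [|i].
  rewrite /layer !sum_desc0 /b eqxx mulr0 mulr_ge0//.
rewrite /layer !sum_descSr mulr_sumr mulr_sumr.
rewrite big_seq [leRHS]big_seq; apply: ler_sum => x xi.
have lx : level x = i by rewrite (level_desc htree hradial xi) (level_root htree).
rewrite (level_root htree) add0n -lx.
set S := \sum_(y <- ch x) `|moment_dev f y|.
have -> : 2 * S = \sum_(y <- ch x) (`|moment_dev f y| + (q (level x))%:R^-1 * S).
  by rewrite big_split/= (sum_ch_cst hradial) mulrA mulfV ?q_neq0// mul1r -/S; ring.
rewrite mulr_sumr big_seq [leRHS]big_seq; apply: ler_sum => y yx.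
have yo := ch_neq_root htree hradial yx.
have ly := level_ch htree hradial yx.
rewrite /b (negbTE yo) -ly.
have := abs_coef_le f yo; rewrite ly /= (parent_ch htree hradial yx) -/S => le.
apply: (le_trans (ler_wpM2l (ltW (mass_gt0 _)) le)).
rewrite mulrA ler_piMl ?addr_ge0 ?mulr_ge0 ?invr_ge0 ?sumr_ge0// ler_pdivrMr ?mul1r//.
apply: le_trans (energy_ge y); rewrite -ly.
exact: sector_mass_ge.
Qed.

Lemma integral_incr_op_le f : integT f -> integT (jump f) ->
  integT (incr_op f) /\
  \int[mu]_z `|incr_op f z| <= (1 - rate)^-1 * (2 * (Cdev * \int[mu]_z `|jump f z|)).
Proof.
move=> fi ji; have [] := integral_coef_le fi ji.
set b := (fun z => if z == o then 0 else `|coef f z|) => bi leb.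
have b0 z : 0 <= b z by rewrite /b; case: ifP.
have [||Fi le] := integral_increments
   (F := fun z => `|incr_op f z|) (fun z => normr_ge0 (incr_op f z)) b0 bi.
- by rewrite incr_op_root normr0.
- move=> z w _ wz; have wo := ch_neq_root htree hradial wz.
  rewrite (incr_op_rec fi wo) /b (negbTE wo).
  rewrite (parent_ch htree hradial wz) addrC; apply: (le_trans (ler_normD _ _)).
  rewrite lerD2r normrM ger0_norm ?invr_ge0// ler_piMl//.
  by apply: le_trans (qV_le_half hq _) _; rewrite invf_le1 ?ler1n.
split.
  rewrite -sector_root.
  by apply: integ_le Fi.
move: le; rewrite sector_root => /le_trans; apply.
by rewrite ler_wpM2l// invr_ge0 ltW.
Qed.

(** * The H^1 norm of a harmonic function *)

Definition grad h z := h z - h (parent z).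

Lemma grad_root h : grad h o = 0.
Proof. by rewrite /grad (parent_root htree) subrr. Qed.

Lemma integ_grad h : integT (grad h) -> integT h.
Proof.
move=> gi; have ai : integ o (fun z => `|grad h z|).
  by apply: integ_setT => //; exact: integrable_norm.
have [||Fi _] := integral_increments
   (F := fun z => `|h z - h o|) (fun z => normr_ge0 _) (fun z => normr_ge0 _) ai.
- by rewrite subrr normr0.
- move=> z w _ wz; rewrite /grad (parent_ch htree hradial wz).
  by rewrite [leRHS]addrC -[h w - h o](subrKA (h z)) ler_normD.
rewrite -sector_root.
apply: (integ_le (g := fun z => `|h z - h o| + `|h o|)).
  by move=> z _; rewrite -{1}(subrK (h o) (h z)) ler_normD.
by apply: integD => //; exact: integ_cst.
Qed.

(** For a balanced function the average over a sector differs from the value at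
    its vertex by at most one increment. *)
Lemma avg_balanced h y : balanced h -> integT h -> `|h y - avg h y| <= `|grad h y|.
Proof.
move=> hh hi; have hy : integ y h by exact: integ_setT.
have B (n : nat) : `|(fun=> 1 : R) n| <= 1 :> R by rewrite normr1.
have := integral_radial_balanced hh B hy.
rewrite /= -/(sector_mass y) -/(moment (fun=> 1) y) => e.
have e2 : \int[mu]_(x in sector y) h x = h (parent y) * sector_mass y +
   grad h y * moment (fun=> 1) y.
  by rewrite -e; apply: eq_Rintegral => z _; rewrite mul1r.
have -> : h y - avg h y = grad h y * (1 - (sector_mass y)^-1 * moment (fun=> 1) y).
  rewrite avgE e2 /grad.
  by have := sector_mass_gt0 y; move: (sector_mass y) (moment _ _) => a b a0; field; rewrite gt_eqF.
rewrite normrM ler_piMr//.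
have L1 : moment (fun=> 1) y <= 2 * sector_mass y by exact: moment1_le.
have L2 : sector_mass y <= moment (fun=> 1) y.
  apply: le_Rintegral => //; first exact: integ_cst.
    by apply: integ_profile; exact: integ_cst.
  by move=> z /(in_sectorP htree) yz; rewrite mulr1 (profile_ge1 yz).
have t1 : 1 <= (sector_mass y)^-1 * moment (fun=> 1) y by rewrite ler_pdivlMl// mulr1.
have t2 : (sector_mass y)^-1 * moment (fun=> 1) y <= 2.
  by rewrite ler_pdivrMl// [leRHS]mulrC.
exact: norm_1sub_le1.
Qed.

Lemma jump_balanced h y : balanced h -> integT h ->
  `|jump h y| <= 2 * `|grad h y| + `|grad h (parent y)|.
Proof.
move=> hh hi; have h1 := avg_balanced y hh hi; have h2 := avg_balanced (parent y) hh hi.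
have -> : jump h y = - (h y - avg h y) + grad h y + (h (parent y) - avg h (parent y)).
  by rewrite /jump /grad; ring.
apply: (le_trans (ler_normD _ _)); apply: lerD => //.
apply: (le_trans (ler_normD _ _)); rewrite normrN; lra.
Qed.

Definition path_sum (b : T -> R) z := \sum_(i < level z) b (iter i parent z).

Lemma path_sum_root b : path_sum b o = 0.
Proof. by rewrite /path_sum (level_root htree) big_ord0. Qed.

Lemma path_sum_rec b z : z != o -> path_sum b z = b z + path_sum b (parent z).
Proof.
move=> zo; rewrite /path_sum (level_rec htree zo) big_ord_recl.
by congr (_ + _); apply: eq_bigr => i _; rewrite lift0 iterSr.
Qed.

Lemma path_sum_ge0 b z : (forall w, 0 <= b w) -> 0 <= path_sum b z.
Proof. by move=> b0; apply: sumr_ge0. Qed.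

Lemma integral_path_sum b : (forall w, 0 <= b w) -> integT b ->
  integT (path_sum b) /\ \int[mu]_z path_sum b z <= (1 - rate)^-1 * \int[mu]_z b z.
Proof.
move=> b0 bi; have bo : integ o b by exact: integ_setT.
set J := \int[mu]_z b z.
rewrite -sector_root /J -sector_root.
apply: integral_increments => //.
- by move=> z; exact: path_sum_ge0.
- by rewrite path_sum_root.
- move=> z w _ wz; rewrite path_sum_rec ?(ch_neq_root htree hradial wz)//.
  by rewrite (parent_ch htree hradial wz) addrC.
Qed.

(** Each jump costs at most two increments at its vertex and one at the parent
    ([jump_balanced]); keeping one increment at [z] in reserve lets the induction
    pay for the latter. *)
Lemma sum_mdiff_balanced h z : balanced h -> integT h ->
  \sum_(1 <= k < (level z).+1) `|mdiff k h z| + `|grad h z| <=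
  3 * path_sum (fun w => `|grad h w|) z.
Proof.
move=> hh hi; elim/(@level_ind T adj o htree): z => [|z zo IH].
  by rewrite path_sum_root (level_root htree) big_geq// grad_root normr0 mulr0 addr0.
have lz := level_rec htree zo.
rewrite path_sum_rec// big_nat_recr ?lz//= -lz.
have -> : \sum_(1 <= k < level z) `|mdiff k h z| =
    \sum_(1 <= k < (level (parent z)).+1) `|mdiff k h (parent z)|.
  rewrite lz; apply: eq_big_nat => k /andP[_ kz].
  by rewrite mdiff_parent// lz.
rewrite mdiff_level//; last by rewrite lz.
have := jump_balanced z hh hi; lra.
Qed.

(** The square function is bounded by the sum of the absolute values of the
    differences, which has at most [level z + 1] nonzero terms. *)
Lemma sqf_balanced_le h z : balanced h -> integT h ->
  (sqf h z <= (3 * path_sum (fun w => `|grad h w|) z)%:E)%E.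
Proof.
move=> hh hi; set Y := path_sum _ z.
have Y0 : 0 <= 3 * Y by rewrite mulr_ge0// path_sum_ge0.
have le n : \sum_(1 <= k < n) `|mdiff k h z| <= 3 * Y.
  apply: (@le_trans _ _ (\sum_(1 <= k < n + (level z).+2) `|mdiff k h z|)).
    case: n => [|n]; first by rewrite big_geq// sumr_ge0.
    by rewrite [leRHS](@big_cat_nat _ _ _ n.+1) ?leq_addr//= lerDl sumr_ge0.
  rewrite (@big_cat_nat _ _ _ (level z).+2) ?leq_addl//=.
  rewrite [X in _ + X]big_nat [X in _ + X]big1 ?addr0.
    rewrite big_nat_recr//=; apply: le_trans (sum_mdiff_balanced z hh hi).
    rewrite lerD2l mdiff_next.
    exact: avg_balanced.
  move=> k /andP[zk _]; rewrite mdiff_far ?normr0//.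
  by case: k zk.
rewrite -(poweR_half_sqr Y0); apply: poweR_half_le.
  by apply: nneseries_ge0 => k _ _; rewrite lee_fin sqr_ge0.
apply: lime_le.
  by apply: is_cvg_nneseries => k _ _; rewrite lee_fin sqr_ge0.
apply: nearW => n; rewrite sumEFin lee_fin.
apply: (le_trans (sum_sqr_le _ _ (fun k => normr_ge0 (mdiff k h z)))).
by rewrite lerXn2r ?nnegrE// sumr_ge0.
Qed.

Lemma h1_norm_balanced_le h : balanced h -> integT (grad h) ->
  (h1_norm adj o mu h <= (3 * ((1 - rate)^-1 * \int[mu]_z `|grad h z|))%:E)%E.
Proof.
move=> hh gi; have hi := integ_grad gi.
have ai : integT (fun z => `|grad h z|) by exact: integrable_norm.
have [Yi Yle] := integral_path_sum (fun w => normr_ge0 (grad h w)) ai.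
set Y := path_sum _ in Yi Yle.
have Y3 : integT (fun z => 3 * Y z) by exact: (integrableZl (hdiscrete _) 3 Yi).
rewrite h1_normE.
apply: (@le_trans _ _ (\int[mu]_z (3 * Y z)%:E)%E).
  by apply: ge0_le_integral => // z _; [exact: sqf_ge0|exact: sqf_balanced_le].
rewrite -[leLHS]fineK; last exact: integrable_fin_num.
rewrite lee_fin -/(Rintegral mu setT (fun z => 3 * Y z)) RintegralZl//.
by rewrite ler_wpM2l.
Qed.

Definition CH1 : R := 3 * ((1 - rate)^-1 * ((1 - rate)^-1 * (2 * Cdev))).

Lemma grad_proj f : integT f -> grad (proj f) = incr_op f.
Proof.
move=> fi; apply/funext => z.
exact: (proj_incr z fi).
Qed.

Lemma proj_H1 f : H1 adj o mu f ->
  H1 adj o mu (proj f) /\ (h1_norm adj o mu (proj f) <= CH1%:E * h1_norm adj o mu f)%E.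
Proof.
move=> [fL f0 fH]; have fi : integT f by apply/Lfun1_integrable.
have [ji jle] := h1_norm_jump fH.
have [gi gle] := integral_incr_op_le fi ji.
have ph := balanced_proj fi.
rewrite -(grad_proj fi) in gi gle.
have hi := integ_grad gi.
have nf : h1_norm adj o mu f \is a fin_num by rewrite ge0_fin_numE// Lnorm_ge0.
have le : (h1_norm adj o mu (proj f) <= CH1%:E * h1_norm adj o mu f)%E.
  apply: (le_trans (h1_norm_balanced_le ph gi)).
  rewrite -[in leRHS](fineK nf) -EFinM lee_fin /CH1 -!mulrA.
  apply: ler_wpM2l => //; apply: ler_wpM2l; first by rewrite invr_ge0 ltW.
  apply: (le_trans gle); rewrite -!mulrA.
  apply: ler_wpM2l; first by rewrite invr_ge0 ltW.
  do 2 apply: ler_wpM2l => //.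
  by apply: ler_wpM2l => //; rewrite invr_ge0 ltW.
split; last exact: le.
split; first exact/Lfun1_integrable.
- by rewrite (mean_balanced ph hi) proj_root.
- by apply: (le_lt_trans le); rewrite -(fineK nf) -EFinM ltry.
Qed.

(** * The BMO norm of a function with bounded increments *)

Lemma cexp0 f x : cexp 0 f x = avg f o.
Proof.
rewrite cexpE ltn0; congr (average mu f (sector _)).
by apply/eqP; rewrite -(level_eq0 htree) (level_iter_parent htree) subn0 subnn.
Qed.

Lemma cexp_pred_sector f y z : y != o -> in_sector y z ->
  cexp (level y).-1 f z = avg f (parent y).
Proof.
move=> yo /andP[lyz /eqP ay]; have ly := level_rec htree yo.
rewrite cexpE ly /=.
rewrite ly in lyz; rewrite ltnNge (ltnW lyz)/=.
by rewrite -(parent_anc lyz) -ly /anc ay.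
Qed.

(** What is used of a function of bounded mean oscillation: the norm bounds the
    mean and the oscillation over each sector about the average over the parent
    sector. *)
Lemma bmo_norm_ge f : (bmo_norm adj o mu f < +oo)%E ->
  let M := fine (bmo_norm adj o mu f) in
  [/\ bmo_norm adj o mu f = M%:E, 0 <= M, `|avg f o| <= M &
  forall y, y != o ->
    \int[mu]_(x in sector y) `|f x - avg f (parent y)| <= M * sector_mass y].
Proof.
move=> fin M.
pose A := ('N[mu]_+oo[EFin \o cexp 0 f])%E.
pose B k := ('N[mu]_+oo[EFin \o cexp k (fun x => `|f x - cexp k.-1 f x|)%R])%E.
pose S := ereal_sup [set B k | k in [set k | (1 <= k)%N]].
have NE : bmo_norm adj o mu f = (A + S)%E by [].
have A0 : (0 <= A)%E by exact: Lnorm_ge0.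
have BS k : (1 <= k)%N -> (B k <= S)%E by move=> k1; apply: ereal_sup_ubound; exists k.
have S0 : (0 <= S)%E by apply: le_trans (BS 1%N _) => //; exact: Lnorm_ge0.
have N0' : (0 <= bmo_norm adj o mu f)%E by rewrite NE adde_ge0.
have NM : bmo_norm adj o mu f = M%:E by rewrite fineK// ge0_fin_numE.
have AM : (A <= M%:E)%E by rewrite -NM NE leeDl.
have BM k : (1 <= k)%N -> (B k <= M%:E)%E.
  by move=> k1; apply: (le_trans (BS k k1)); rewrite -NM NE leeDr.
split=> //.
- by rewrite fine_ge0.
- rewrite -lee_fin; apply: le_trans AM.
  have := Lnorm_infty_ge (cexp 0 f) o.
  by rewrite cexp0.
- move=> y yo; have ly : (1 <= level y)%N by rewrite lt0n (level_eq0 htree).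
  pose F x := `|f x - cexp (level y).-1 f x|.
  have := le_trans (Lnorm_infty_ge (cexp (level y) F) y) (BM _ ly).
  rewrite cexpE ltnn (anc_level y) lee_fin.
  move=> /(le_trans (ler_norm _)); rewrite avgE ler_pdivrMl//.
  rewrite mulrC (@eq_integral_sector F (fun x => `|f x - avg f (parent y)|))//.
  by move=> z yz; rewrite /F cexp_pred_sector.
Qed.

(** Conversely, the dyadic sets of generation [k] on which [h] differs from its
    average of generation [k - 1] are the sectors at level [k] and the singletons
    at level [k - 1]. *)
Lemma bmo_norm_le h B0 B1 : `|avg h o| <= B0 ->
  (forall x, `|h x - avg h x| <= B1) ->
  (forall y, y != o ->
    \int[mu]_(x in sector y) `|h x - avg h (parent y)| <= B1 * sector_mass y) ->
  (bmo_norm adj o mu h <= (B0 + B1)%:E)%E.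
Proof.
move=> h0 h1 h2; rewrite /bmo_norm EFinD; apply: leeD.
  by apply: Lnorm_infty_le => z; rewrite cexp0.
apply: ge_ereal_sup => _ [k /= k1 <-]; apply: Lnorm_infty_le => z.
pose F x := `|h x - cexp k.-1 h x|.
have B10 : 0 <= B1 by exact: le_trans (normr_ge0 _) (h1 o).
rewrite -/F cexpE; case: ltnP => zk.
  rewrite /F normr_id cexpE; case: ltnP => zk'.
    by rewrite subrr normr0.
  have -> : k.-1 = level z by lia.
  by rewrite (anc_level z).
set y := anc _ _.
have ly : level y = k by rewrite (level_iter_parent htree) subKn.
have yo : y != o by rewrite -(level_eq0 htree) ly -lt0n.
rewrite avgE ger0_norm; last first.
  rewrite mulr_ge0 ?invr_ge0 ?(ltW (sector_mass_gt0 y))//; apply: Rintegral_ge0.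
  by move=> x _; exact: normr_ge0.
rewrite ler_pdivrMl// mulrC; apply: le_trans (h2 y yo).
rewrite (@eq_integral_sector F (fun x => `|h x - avg h (parent y)|))//.
by move=> x yx; rewrite /F -ly cexp_pred_sector.
Qed.

(** Moments are at most twice the oscillation, there are two of them in the
    coefficient (that of [y] and the mean over siblings), and the energy is at
    least the sector mass. *)
Lemma abs_coef_bmo f M y : integT f -> 0 <= M ->
  (forall z, z != o ->
    \int[mu]_(x in sector z) `|f x - avg f (parent z)| <= M * sector_mass z) ->
  y != o -> `|coef f y| <= 4 * M.
Proof.
move=> fi M0 fM yo.
have dev w : w != o -> level w = level y -> `|moment_dev f w| <= 2 * (M * sector_mass y).
  move=> wo lw; rewrite -(sector_mass_level lw).
  apply: (le_trans (abs_moment_dev_le (integ_setT w fi))).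
  by apply: ler_wpM2l => //; exact: fM.
apply: (le_trans (abs_coef_le f yo)).
rewrite ler_pdivrMl//.
apply: (@le_trans _ _ (2 * (M * sector_mass y) + 2 * (M * sector_mass y))).
  apply: lerD; first exact: dev.
  rewrite ler_pdivrMl ?(q_gt0 hq)//.
  rewrite -{1}(level_parent htree) -(sum_ch_cst hradial) big_seq [leRHS]big_seq.
  apply: ler_sum => w wy; apply: dev; first exact: (ch_neq_root htree hradial wy).
  by rewrite (level_ch htree hradial wy) -(level_rec htree yo).
rewrite (_ : _ + _ = 4 * M * sector_mass y); last by ring.
by rewrite [leRHS]mulrC ler_wpM2l ?mulr_ge0// energy_ge.
Qed.

(** The inherited part of the increment is at most halved, so the coefficients sum
    as a geometric series along the path to the root. *)
Lemma abs_incr_op_bmo f M y : integT f -> 0 <= M ->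
  (forall z, z != o -> `|coef f z| <= M) -> `|incr_op f y| <= 2 * M.
Proof.
move=> fi M0 cM; elim/(@level_ind T adj o htree): y => [|y yo IH].
  by rewrite incr_op_root normr0 mulr_ge0.
rewrite incr_op_rec//; apply: (le_trans (ler_normD _ _)).
have q0 : 0 <= (q (level (parent y)))%:R^-1 :> R by rewrite invr_ge0.
have := ler_pM q0 (normr_ge0 _) (qV_le_half hq (level (parent y))) IH.
rewrite (normrM (q (level (parent y)))%:R^-1) (ger0_norm q0); have := cM y yo; lra.
Qed.

(** Sectors look from their vertex like sets whose mass decays geometrically with
    the distance, so a function that grows linearly with the distance has
    bounded mean oscillation. *)
Lemma oscillation_le h G : (forall z, `|grad h z| <= G) ->
  integT h /\ forall y, \int[mu]_(x in sector y) `|h x - h y| <=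
                        (1 - rate)^-1 * G * sector_mass y.
Proof.
move=> hG; have G0 : 0 <= G by exact: le_trans (normr_ge0 _) (hG o).
have osc y : integ y (fun z => `|h z - h y|) /\
    \int[mu]_(x in sector y) `|h x - h y| <= (1 - rate)^-1 * G * sector_mass y.
  have [||Fi le] := integral_increments (F := fun z => `|h z - h y|)
    (fun z => normr_ge0 _) (fun _ => G0) (integ_cst y G).
  - by rewrite subrr normr0.
  - move=> z w _ wz; have := hG w; rewrite /grad (parent_ch htree hradial wz) => le.
    rewrite -[h w - h y](subrKA (h z)) [leRHS]addrC.
    by apply: (le_trans (ler_normD _ _)); rewrite lerD2r.
  split=> //; apply: (le_trans le).
  by rewrite Rintegral_cst// sector_massE mulrA.
split; last by move=> y; case: (osc y).
rewrite -sector_root.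
apply: (integ_le (g := fun z => `|h z - h o| + `|h o|)).
  by move=> z _; rewrite -{1}(subrK (h o) (h z)) ler_normD.
by apply: integD; [case: (osc o)|exact: integ_cst].
Qed.

Lemma avg_oscillation_le h y B : integ y h ->
  \int[mu]_(x in sector y) `|h x - h y| <= B * sector_mass y -> `|h y - avg h y| <= B.
Proof.
move=> hi hB; have ci : integ y (fun=> h y) by exact: integ_cst.
have e : \int[mu]_(x in sector y) (h x - h y) = - (sector_mass y * (h y - avg h y)).
  by rewrite RintegralB// integral_avg Rintegral_cst// sector_massE; ring.
have : `|sector_mass y * (h y - avg h y)| <= B * sector_mass y.
  rewrite -normrN -e; apply: le_trans hB.
  exact: (le_normr_Rintegral (hdiscrete _) (integB hi ci)).
by rewrite normrM ger0_norm ?(ltW (sector_mass_gt0 y))// mulrC ler_pM2r.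
Qed.

Definition CBMO : R := 1 + 8 * (2 * (1 - rate)^-1 + 1).

Lemma proj_BMO f : BMO adj o mu f ->
  BMO adj o mu (proj f) /\ (bmo_norm adj o mu (proj f) <= CBMO%:E * bmo_norm adj o mu f)%E.
Proof.
move=> [fL fin]; have fi : integT f by apply/Lfun1_integrable.
have [NM M0 fM floc] := bmo_norm_ge fin.
set M := fine _ in NM M0 fM floc; pose G := 2 * (4 * M).
have M40 : 0 <= 4 * M by rewrite mulr_ge0.
have gG z : `|grad (proj f) z| <= G.
  rewrite grad_proj//; apply: abs_incr_op_bmo => // w wo.
  exact: abs_coef_bmo.
have G0 : 0 <= G by rewrite mulr_ge0.
have [hi osc] := oscillation_le gG.
set h := proj f in gG hi osc *; set B := (1 - rate)^-1 * G in osc.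
have B0 : 0 <= B by rewrite mulr_ge0// invr_ge0 ltW.
have hy y : integ y h by exact: integ_setT.
have hosc y : `|h y - avg h y| <= B by apply: avg_oscillation_le.
have le : (bmo_norm adj o mu h <= (M + (2 * B + G))%:E)%E.
  apply: bmo_norm_le.
  - rewrite avgE sector_root (mean_balanced (balanced_proj fi) hi) proj_root.
    by move: fM; rewrite avgE sector_root.
  - by move=> x; apply: (le_trans (hosc x)); lra.
  move=> y yo.
  have ai : integ y (fun x => `|h x - h y|).
    by apply: integ_abs; apply: integB => //; exact: integ_cst.
  apply: (@le_trans _ _ (\int[mu]_(x in sector y) (`|h x - h y| + (G + B)))).
    apply: le_Rintegral => //.
    + by apply: integ_abs; apply: integB => //; exact: integ_cst.
    + by apply: integD => //; exact: integ_cst.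
    + move=> x _; rewrite -[h x - avg h (parent y)](subrKA (h y)).
      apply: (le_trans (ler_normD _ _)); rewrite lerD2l
        -[h y - avg h (parent y)](subrKA (h (parent y))).
      apply: (le_trans (ler_normD _ _)).
      by rewrite lerD//; exact: gG.
  rewrite RintegralD//; last exact: integ_cst.
  rewrite Rintegral_cst// sector_massE.
  rewrite [leRHS](_ : _ = B * sector_mass y + (G + B) * sector_mass y); last by ring.
  by rewrite lerD2r.
have {}le : (bmo_norm adj o mu h <= CBMO%:E * bmo_norm adj o mu f)%E.
  apply: (le_trans le); rewrite NM -EFinM lee_fin /CBMO /B /G.
  by rewrite le_eqVlt; apply/orP; left; apply/eqP; ring.
split; last exact: le.
split; first exact/Lfun1_integrable.
by apply: (le_lt_trans le); rewrite NM -EFinM ltry.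
Qed.

End TreeMeasure.

Theorem theorem4 (R : realType) (d : measure_display) (T : measurableType d)
    (adj : rel T) (o : T) (q : nat -> nat) (alpha : R) (mu : probability T R)
    (hdiscrete : forall A : set T, measurable A)
    (htree : is_tree adj)
    (hq : forall n : nat, (2 <= q n)%N)
    (hradial : radial adj o q)
    (halpha : 1 < alpha)
    (hmu : tree_measure adj o mu q alpha) :
  maps_boundedly (bergman_projector adj mu) (H1 adj o mu) (h1_norm adj o mu) /\
  maps_boundedly (bergman_projector adj mu) (BMO adj o mu) (bmo_norm adj o mu).
Proof.
case: hmu => c hc hmuE.
have PE := bergman_projectorE hdiscrete htree hradial hq hc hmuE.
split.
  exists (@CH1 R alpha) => f fH; rewrite PE.
  exact: (proj_H1 hdiscrete htree hradial hq halpha hc hmuE fH).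
exists (@CBMO R alpha) => f fB; rewrite PE.
exact: (proj_BMO hdiscrete htree hradial hq halpha hc hmuE fB).
Qed.
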